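(* Let $G$ be a graph on $n$ vertices with minimum degree $\delta$. (A) Suppose $G$ is planar. Then: if $\delta = 1$, $\alpha_{2-\mathrm{reg}}(G) \ge \frac{4}{83}(n+3)$; if $\delta = 2$, $\alpha_{2-\mathrm{reg}}(G) \ge \frac{3}{55}(n+4)$; if $\delta = 3$, $\alpha_{2-\mathrm{reg}}(G) \ge \frac{1}{16}(n+4)$; if $\delta = 4$, $\alpha_{2-\mathrm{reg}}(G) \ge \frac{2}{23}(n+6)$; if $\delta = 5$, $\alpha_{2-\mathrm{reg}}(G) \ge \frac{1}{7}(n+12)$. If moreover $G$ is maximal planar and $\delta = 3$, then $\alpha_{2-\mathrm{reg}}(G) \ge \frac{1}{14}(n+6)$. (B) Suppose $G$ is outerplanar and $\delta = 2$. Then $\alpha_{2-\mathrm{reg}}(G) \ge \frac{1}{8}(n+3)$.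
   Context: Graphs are finite and simple. $\alpha_{2-\mathrm{reg}}(G)$ is the maximum cardinality of a set $S$ of vertices of $G$, all having the same degree in $G$, such that the induced subgraph $G[S]$ has maximum degree at most $2$. A maximal planar graph is a planar graph with the maximum possible number of edges for its order $n$ (namely $3n-6$ when $n \ge 3$). *)

(* Defs.v *)
From HB Require Import structures.
From mathcomp Require Import all_boot all_order all_algebra.
From mathcomp Require Import all_classical all_reals all_analysis.
Import numFieldNormedType.Exports.

Set Implicit Arguments.
Unset Strict Implicit.
Unset Printing Implicit Defensive.

Import Order.TTheory GRing.Theory Num.Theory.
Local Open Scope classical_set_scope.
Local Open Scope ring_scope.

Record sgraph := SGraph {
  vertex :> finType;
  adj : rel vertex;
  adj_sym : symmetric adj;
  adj_irrefl : irreflexive adj }.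

Section Graph.
Variable G : sgraph.
Implicit Types (u v : G) (S : {set G}).

Definition degree v : nat := #|[set w : G | adj v w]|%SET.

(* The default #|G| exceeds every degree, so for a nonempty graph this is the
   true minimum. *)
Definition min_degree : nat := \big[minn/#|G|]_(v : G) degree v.

Definition edges : {set {set G}} :=
  [set [set x.1; x.2] | x : G * G & adj x.1 x.2]%SET.

Definition same_degree S : bool :=
  [forall u in S, forall v in S, degree u == degree v].

Definition induced_degree S v : nat := #|[set w in S | adj v w]|%SET.

Definition induced_max_degree S : nat := \max_(v in S) induced_degree S v.

Definition alpha2reg : nat :=
  \max_(S : {set G} | same_degree S && (induced_max_degree S <= 2)%N) #|S|.

End Graph.

Section Drawing.
Variables (R : realType) (G : sgraph).
Notation plane := (R * R)%type.

Definition arc_between (a b : plane) (A : set plane) : Prop :=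
  exists f : R -> plane,
    [/\ {within `[0, 1], continuous f}, {in `[0, 1] &, injective f},
        f 0 = a, f 1 = b & f @` `[0, 1] = A].

(* The vertex v is drawn at p v and the edge uv as the arc A u v; the values of
   A at non-adjacent pairs are irrelevant. The last two clauses say that the
   interior of an arc contains no vertex and no point of another arc. *)
Definition plane_drawing (p : G -> plane) (A : G -> G -> set plane) : Prop :=
  [/\ injective p,
      forall u v, adj u v -> arc_between (p u) (p v) (A u v),
      forall u v, adj u v -> A u v = A v u,
      forall u v w, adj u v -> A u v (p w) -> w = u \/ w = v
    & forall u v x y, adj u v -> adj x y ->
        [set u; v]%SET != [set x; y]%SET -> A u v `&` A x y `<=` range p].

Definition drawing_points (p : G -> plane) (A : G -> G -> set plane) :
    set plane :=
  range p `|` [set z | exists u v, adj u v /\ A u v z].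

(* Since connected_component X z is empty when z is not in X, this is the
   unbounded component of the complement of the drawing. *)
Definition outer_face (p : G -> plane) (A : G -> G -> set plane) : set plane :=
  [set z | ~ bounded_set (connected_component (~` drawing_points p A) z)].

Definition boundary (X : set plane) : set plane := closure X `\` interior X.

Definition planar : Prop := exists p A, plane_drawing p A.

Definition outerplanar : Prop :=
  exists p A, plane_drawing p A /\
    forall v, boundary (outer_face p A) (p v).

End Drawing.

Definition maximal_planar (R : realType) (G : sgraph) : Prop :=
  planar R G /\
  forall H : sgraph, planar R H -> #|H| = #|G| -> (#|edges H| <= #|edges G|)%N.

(* Main.v *)
(* Let n_d be the number of vertices of degree d and a = alpha2reg G. By Euler's
   bound e <= 3n - 6, the sum of K - deg v over all vertices is at least
   (K - 6) n + 12, and at most the sum of (K - d) n_d over d < K. A colouring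
   with k colours and the fewest monochromatic edges (Lovasz) splits a degree
   class with d < 3k into parts of induced degree at most 2, so n_d <= k a. The
   bounds follow with K = 10, 9, 9, 8, 7 for delta = 1, ..., 5; for delta = 1
   the constant would be 84, and 83 is reached with 27 n_3 <= 50 a, which comes
   from a greedy dominating set of G[V_3]. In a maximal planar graph a vertex of
   degree 3 cannot have three neighbours of degree 3, so there n_3 <= a.

   Euler's bound is obtained without the Jordan curve theorem. A graph with
   e >= 3n - 5 has a K5 minor (Mader): contract edges as long as one lies in at
   most two triangles; then the neighbourhood of a vertex of degree at most 5 is
   so dense that K5 appears after at most one more contraction. A plane drawing
   by arcs yields drawings by chains of arbitrarily small steps in which
   independent edges stay a fixed distance apart; this passes to minors, and K5
   has no such drawing, because the number of crossings between independent
   edges of a polygonal K5 in general position is always odd (van Kampen).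

   For outerplanar graphs e <= 2n - 3 follows from Euler's bound for the cone
   over G, which is drawn with its apex in the outer face. *)
From Stdlib Require Import Btauto.
Require Import Defs.
From mathcomp Require Import all_boot all_order all_algebra.
From mathcomp Require Import all_classical all_reals all_analysis.
From mathcomp Require Import ring lra zify.
Import Order.TTheory GRing.Theory Num.Theory.
Import numFieldNormedType.Exports.
Local Open Scope ring_scope.

Set Implicit Arguments.
Unset Strict Implicit.
Unset Printing Implicit Defensive.

(** * Crossing parity *)

(** Quantification over the booleans as a boolean, so that a tautology in ten variables can be
    settled by computation. *)
Definition bool_all (P : bool -> bool) : bool := P true && P false.

Lemma bool_allP (P : bool -> bool) : bool_all P -> forall b, P b.
Proof. by move=> /andP[h1 h2] []. Qed.

Lemma bool10_tauto
    (P : bool -> bool -> bool -> bool -> bool -> bool -> bool -> bool -> bool -> bool -> bool) :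
  bool_all (fun b1 => bool_all (fun b2 => bool_all (fun b3 => bool_all (fun b4 =>
  bool_all (fun b5 => bool_all (fun b6 => bool_all (fun b7 => bool_all (fun b8 =>
  bool_all (fun b9 => bool_all (P b1 b2 b3 b4 b5 b6 b7 b8 b9)))))))))) ->
  forall b1 b2 b3 b4 b5 b6 b7 b8 b9 b10, P b1 b2 b3 b4 b5 b6 b7 b8 b9 b10.
Proof.
move=> h b1 b2 b3 b4 b5 b6 b7 b8 b9 b10.
move: (bool_allP h b1) => /bool_allP/(_ b2)/bool_allP/(_ b3)/bool_allP/(_ b4).
move=> /bool_allP/(_ b5)/bool_allP/(_ b6)/bool_allP/(_ b7)/bool_allP/(_ b8).
by move=> /bool_allP/(_ b9)/bool_allP/(_ b10).
Qed.

Section Orientation.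
Variable R : realFieldType.
Implicit Types a b c d e z : R * R.

(** Twice the signed area of the triangle. *)
Definition orient a b c : R :=
  (b.1 - a.1) * (c.2 - a.2) - (b.2 - a.2) * (c.1 - a.1).

Definition ccw a b c : bool := 0 < orient a b c.

(** Each segment separates the ends of the other. For points in general position this is a proper
    crossing; a collinear triple counts as clockwise. *)
Definition cross a b c d : bool :=
  (ccw a b c (+) ccw a b d) && (ccw c d a (+) ccw c d b).

Definition in_triangle a b c z : bool :=
  (ccw a b z == ccw b c z) && (ccw b c z == ccw c a z).

Lemma ccw_rot a b c : ccw b c a = ccw a b c.
Proof. by rewrite /ccw /orient; congr (0 < _); ring. Qed.

Lemma ccw_swap a b c : orient a b c != 0 -> ccw b a c = ~~ ccw a b c.
Proof.
have -> : ccw b a c = (orient a b c < 0).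
  by rewrite /ccw -oppr_gt0; congr (0 < _); rewrite /orient; ring.
by rewrite /ccw; case: ltgtP => // -> /eqP.
Qed.

Lemma sign_mul (x y : R) :
  x != 0 -> y != 0 -> (0 < x * y) = ~~ ((0 < x) (+) (0 < y)).
Proof.
case: (ltgtP x 0) => // hx _; case: (ltgtP y 0) => // hy _ /=.
- by rewrite nmulr_rgt0.
- by rewrite nmulr_rgt0 //; apply/negbTE; rewrite -leNgt ltW.
- by rewrite pmulr_rgt0 //; apply/negbTE; rewrite -leNgt ltW.
- by rewrite pmulr_rgt0.
Qed.

(* The signs permitted by the Grassmann-Pluecker relation
   [abc][ade] - [abd][ace] + [abe][acd] = 0. *)
Lemma grassmann_pluecker_sign a b c d e :
  orient a b c != 0 -> orient a b d != 0 -> orient a b e != 0 ->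
  orient a c d != 0 -> orient a c e != 0 -> orient a d e != 0 ->
  (ccw a b c (+) ccw a d e == ccw a b e (+) ccw a c d) ==>
  (ccw a b d (+) ccw a c e == ccw a b c (+) ccw a d e).
Proof.
move=> h1 h2 h3 h4 h5 h6; apply/implyP => /eqP E.
have gp : orient a b c * orient a d e + orient a b e * orient a c d =
  orient a b d * orient a c e by rewrite /orient; ring.
have := sign_mul h1 h6; have := sign_mul h2 h5; have := sign_mul h3 h4.
rewrite -/(ccw _ _ _) -!/(ccw _ _ _) -E -gp => s1 s2 s3.
have nz : orient a b c * orient a d e != 0 by rewrite mulf_neq0.
have nz' : orient a b e * orient a c d != 0 by rewrite mulf_neq0.
rewrite -(inj_eq negb_inj) -s2 -s3.
case: (ltgtP (orient a b c * orient a d e) 0) s3 nz => // h s3 _.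
- have h' : orient a b e * orient a c d < 0.
    by rewrite lt_neqAle nz' /= leNgt s1 -s3.
  by apply/eqP/negbTE; rewrite -leNgt; apply: ltW; lra.
- have h' : 0 < orient a b e * orient a c d by rewrite s1 -s3.
  by apply/eqP; lra.
Qed.

Definition general_position (T : eqType) (q : T -> R * R) (l : seq T) : Prop :=
  forall i j k, i \in l -> j \in l -> k \in l ->
    i != j -> i != k -> j != k -> orient (q i) (q j) (q k) != 0.

Lemma general_position_sub (T : eqType) (q : T -> R * R) (l l' : seq T) :
  {subset l' <= l} -> general_position q l -> general_position q l'.
Proof. by move=> s g i j k /s hi /s hj /s hk; apply: g. Qed.

(** First half: the segment [d e] meets the boundary of the triangle [a b c] an odd number of times
    exactly when one of its ends is inside and the other outside. Second half: a straight K5 has an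
    odd number of crossings between independent edges. *)
Definition five_points_conclusion a b c d e : bool :=
  ((cross a b d e (+) cross b c d e (+) cross c a d e) ==
     (in_triangle a b c d (+) in_triangle a b c e)) &&
  (cross a b c d (+) cross a b c e (+) cross a b d e (+)
  (cross a c b d (+) cross a c b e (+) cross a c d e) (+)
  (cross a d b c (+) cross a d b e (+) cross a d c e) (+)
  (cross a e b c (+) cross a e b d (+) cross a e c d) (+)
  (cross b c d e (+) cross b d c e (+) cross b e c d)).

(* Normalizes all orientations of five points to increasing order and adds the
   five Grassmann-Pluecker constraints; what remains is a tautology in the ten
   remaining signs. *)
Lemma five_points a b c d e :
  orient a b c != 0 -> orient a b d != 0 -> orient a b e != 0 ->
  orient a c d != 0 -> orient a c e != 0 -> orient a d e != 0 ->
  orient b c d != 0 -> orient b c e != 0 -> orient b d e != 0 ->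
  orient c d e != 0 ->
  five_points_conclusion a b c d e.
Proof.
move=> abc abd abe acd ace ade bcd bce bde cde.
have rot x y z : orient x y z != 0 -> orient y z x != 0.
  by rewrite /orient => h; apply: contra_neq h => h; rewrite -[RHS]h; ring.
have sw x y z : orient x y z != 0 -> orient y x z != 0.
  by rewrite /orient => h; apply: contra_neq h => /eqP h;
     apply/eqP; rewrite -oppr_eq0 -(eqP h); apply/eqP; ring.
have G1 := grassmann_pluecker_sign abc abd abe acd ace ade.
have G2 := grassmann_pluecker_sign (sw _ _ _ abc) (sw _ _ _ abd) (sw _ _ _ abe) bcd bce bde.
have G3 := grassmann_pluecker_sign (rot _ _ _ (rot _ _ _ abc)) (sw _ _ _ acd) (sw _ _ _ ace) (sw _ _ _ bcd) (sw _ _ _ bce) cde.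
have G4 := grassmann_pluecker_sign (rot _ _ _ (rot _ _ _ abd)) (rot _ _ _ (rot _ _ _ acd)) (sw _ _ _ ade) (rot _ _ _ (rot _ _ _ bcd)) (sw _ _ _ bde) (sw _ _ _ cde).
have G5 := grassmann_pluecker_sign (rot _ _ _ (rot _ _ _ abe)) (rot _ _ _ (rot _ _ _ ace)) (rot _ _ _ (rot _ _ _ ade)) (rot _ _ _ (rot _ _ _ bce)) (rot _ _ _ (rot _ _ _ bde)) (rot _ _ _ (rot _ _ _ cde)).
have N x y z : orient x y z != 0 -> [/\ ccw y z x = ccw x y z,
   ccw z x y = ccw x y z, ccw y x z = ~~ ccw x y z, ccw x z y = ~~ ccw x y z
   & ccw z y x = ~~ ccw x y z].
  move=> h; split.
  - exact: ccw_rot.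
  - by rewrite ccw_rot ccw_rot.
  - exact: ccw_swap.
  - by rewrite -[LHS]ccw_rot (ccw_swap (rot _ _ _ h)) ccw_rot.
  - by rewrite (ccw_swap (rot _ _ _ h)) ccw_rot.
rewrite /five_points_conclusion /cross /in_triangle.
have [A1 A2 A3 A4 A5] := N _ _ _ abc.
have [B1 B2 B3 B4 B5] := N _ _ _ abd.
have [C1 C2 C3 C4 C5] := N _ _ _ abe.
have [D1 D2 D3 D4 D5] := N _ _ _ acd.
have [E1 E2 E3 E4 E5] := N _ _ _ ace.
have [F1 F2 F3 F4 F5] := N _ _ _ ade.
have [H1 H2 H3 H4 H5] := N _ _ _ bcd.
have [I1 I2 I3 I4 I5] := N _ _ _ bce.
have [J1 J2 J3 J4 J5] := N _ _ _ bde.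
have [K1 K2 K3 K4 K5] := N _ _ _ cde.
rewrite ?A1 ?A2 ?A3 ?A4 ?A5 ?B1 ?B2 ?B3 ?B4 ?B5 ?C1 ?C2 ?C3 ?C4 ?C5
  ?D1 ?D2 ?D3 ?D4 ?D5 ?E1 ?E2 ?E3 ?E4 ?E5 ?F1 ?F2 ?F3 ?F4 ?F5
  ?H1 ?H2 ?H3 ?H4 ?H5 ?I1 ?I2 ?I3 ?I4 ?I5 ?J1 ?J2 ?J3 ?J4 ?J5
  ?K1 ?K2 ?K3 ?K4 ?K5 in G1 G2 G3 G4 G5 *.
apply/implyP: G5; apply/implyP: G4; apply/implyP: G3; apply/implyP: G2.
apply/implyP: G1.
move: (ccw a b c) (ccw a b d) (ccw a b e) (ccw a c d) (ccw a c e) (ccw a d e)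
  (ccw b c d) (ccw b c e) (ccw b d e) (ccw c d e) => b1 b2 b3 b4 b5 b6 b7 b8 b9 b10.
match goal with |- is_true ?X =>
  match eval pattern b1, b2, b3, b4, b5, b6, b7, b8, b9, b10 in X with
  ?P _ _ _ _ _ _ _ _ _ _ => refine (@bool10_tauto P _ _ _ _ _ _ _ _ _ _ _)
  end end.
by vm_compute.
Qed.

Lemma five_points_general (T : eqType) (q : T -> R * R) (i1 i2 i3 i4 i5 : T) :
  uniq [:: i1; i2; i3; i4; i5] ->
  general_position q [:: i1; i2; i3; i4; i5] ->
  five_points_conclusion (q i1) (q i2) (q i3) (q i4) (q i5).
Proof.
move=> + g; rewrite /= !inE !negb_or !andbT.
move=> /and4P[/and4P[n12 n13 n14 n15] /and3P[n23 n24 n25] /andP[n34 n35] n45].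
by apply: five_points; apply: g; rewrite ?inE ?eqxx ?orbT.
Qed.

Section General.
Variables (T : eqType) (q : T -> R * R) (i1 i2 i3 i4 i5 : T).
Hypothesis u : uniq [:: i1; i2; i3; i4; i5].
Hypothesis g : general_position q [:: i1; i2; i3; i4; i5].

Lemma cross_triangle :
  cross (q i1) (q i2) (q i4) (q i5) (+) cross (q i2) (q i3) (q i4) (q i5)
    (+) cross (q i3) (q i1) (q i4) (q i5) =
  in_triangle (q i1) (q i2) (q i3) (q i4) (+)
    in_triangle (q i1) (q i2) (q i3) (q i5).
Proof. by case/andP: (five_points_general u g) => /eqP. Qed.

(** The 15 pairs of independent edges of K5, summed modulo 2. *)
Definition five_crossings X : bool :=
  X i1 i2 i3 i4 (+) X i1 i2 i3 i5 (+) X i1 i2 i4 i5 (+)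
  (X i1 i3 i2 i4 (+) X i1 i3 i2 i5 (+) X i1 i3 i4 i5) (+)
  (X i1 i4 i2 i3 (+) X i1 i4 i2 i5 (+) X i1 i4 i3 i5) (+)
  (X i1 i5 i2 i3 (+) X i1 i5 i2 i4 (+) X i1 i5 i3 i4) (+)
  (X i2 i3 i4 i5 (+) X i2 i4 i3 i5 (+) X i2 i5 i3 i4).

Lemma five_crossings_odd :
  five_crossings (fun i j k l => cross (q i) (q j) (q k) (q l)).
Proof. by case/andP: (five_points_general u g). Qed.

End General.

End Orientation.

(** * Crossing parity of polygonal chains *)

Section Chains.
Variables (R : realFieldType) (T : eqType) (q : T -> R * R) (l : seq T).
Hypothesis gen : general_position q l.
Implicit Types (u v x y z d e : T) (s t : seq T).

Fixpoint segment_crossings x s d e : bool :=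
  if s is y :: s' then
    cross (q x) (q y) (q d) (q e) (+) segment_crossings y s' d e
  else false.

Fixpoint chain_crossings x s d t : bool :=
  if t is e :: t' then segment_crossings x s d e (+) chain_crossings x s e t'
  else false.

(** Parity of the number of triangles with apex [u] over the edges of the path [x :: s] that contain
    [z]; in general position, the winding number modulo 2 about [z] of that path closed up through
    [u]. *)
Fixpoint fan u x s z : bool :=
  if s is y :: s' then in_triangle (q u) (q x) (q y) (q z) (+) fan u y s' z
  else false.

(** The chain and the segment back to [u] form a closed polygon, which [d e] crosses oddly iff [fan]
    differs at [d] and [e]. The induction replaces the first two edges [u x], [x y] by [u y], at the
    cost of one triangle. *)
Lemma segment_crossings_fan u x s d e :
  uniq (u :: x :: s) -> d != e -> d \notin u :: x :: s ->
  e \notin u :: x :: s -> {subset [:: d, e, u, x & s] <= l} ->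
  segment_crossings u (x :: s) d e =
  cross (q u) (q (last x s)) (q d) (q e) (+) fan u x s d (+) fan u x s e.
Proof.
elim: s x => [|y s IH] x; first by move=> *; rewrite /= !addbF.
move=> U de dn en sl.
have tri : cross (q u) (q x) (q d) (q e) (+) cross (q x) (q y) (q d) (q e) =
  cross (q u) (q y) (q d) (q e) (+)
  (in_triangle (q u) (q x) (q y) (q d) (+) in_triangle (q u) (q x) (q y) (q e)).
  have sl5 i : i \in [:: u; x; y; d; e] -> i \in l.
    move=> hi; apply: sl; move: hi; rewrite !inE.
    by do ![case/orP]; move=> ->; rewrite ?orbT.
  move: U dn en; rewrite /= !inE !negb_or.
  move=> /and3P[/and3P[ux uy us] /andP[xy xs] ys].
  move=> /and4P[du dx dy ds] /and4P[eu ex ey es].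
  have U5 : uniq [:: u; x; y; d; e].
    by rewrite /= !inE !negb_or !(eq_sym _ d) !(eq_sym _ e) ux uy xy du dx dy
      eu ex ey eq_sym de.
  have G5 := general_position_sub sl5 gen.
  rewrite -(cross_triangle U5 G5).
  have o z : z \in [:: d; e] -> ccw (q y) (q u) (q z) = ~~ ccw (q u) (q y) (q z).
    move=> hz; apply: ccw_swap; apply: gen; rewrite ?sl5 ?inE ?eqxx ?orbT //.
    + by move: hz; rewrite !inE => /orP[]->; rewrite ?orbT.
    + by move: hz; rewrite !inE => /orP[]/eqP->; rewrite eq_sym.
    + by move: hz; rewrite !inE => /orP[]/eqP->; rewrite eq_sym.
  have -> : cross (q y) (q u) (q d) (q e) = cross (q u) (q y) (q d) (q e).
    rewrite /cross !o ?inE ?eqxx ?orbT //; congr (_ && _); last by rewrite addbC.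
    by rewrite addNb addbN negbK.
  by do 3!case: (cross _ _ _ _).
have {}IH : cross (q u) (q y) (q d) (q e) (+) segment_crossings y s d e =
    cross (q u) (q (last y s)) (q d) (q e) (+) fan u y s d (+) fan u y s e.
  apply: IH => //.
  - by move: U; rewrite /= !inE !negb_or => /and3P[/and3P[_ -> ->] _ ->].
  - by move: dn; rewrite !inE !negb_or => /and4P[-> _ -> ->].
  - by move: en; rewrite !inE !negb_or => /and4P[-> _ -> ->].
  - move=> i hi; apply: sl; move: hi; rewrite !inE.
    by do 4?[case/orP]; move=> ->; rewrite ?orbT.
rewrite /= addbA tri.
move: IH; case: (cross (q u) (q y) _ _); case: (segment_crossings y s d e);
case: (cross (q u) (q (last y s)) _ _); case: (fan u y s d);
case: (fan u y s e) => //= _;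
by case: (in_triangle _ _ _ (q d)); case: (in_triangle _ _ _ (q e)).
Qed.

(** Summing over the steps of [d :: t], the [fan] terms of the inner points cancel in pairs and only
    the two ends remain. *)
Lemma chain_crossings_fan u x s d t :
  uniq (u :: x :: s) -> uniq (d :: t) ->
  (forall z, z \in d :: t -> z \notin u :: x :: s) ->
  {subset d :: t <= l} -> {subset u :: x :: s <= l} ->
  chain_crossings u (x :: s) d t =
  chain_crossings u [:: last x s] d t (+) fan u x s d (+) fan u x s (last d t).
Proof.
move=> U; elim: t d => [|e t IH] d; first by rewrite /= addbb.
move=> U' dis sl' sl.
have d_out := dis d (mem_head _ _).
have e_out : e \notin u :: x :: s by apply: dis; rewrite !inE eqxx orbT.
have dl : d \in l by apply: sl'; rewrite mem_head.
have el : e \in l by apply: sl'; rewrite !inE eqxx orbT.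
have [de U''] : d != e /\ uniq (e :: t).
  by move: U'; rewrite cons_uniq inE negb_or => /andP[/andP[-> _] ->].
have {}IH := IH e U'' _ _ sl.
have -> : chain_crossings u (x :: s) d (e :: t) =
  segment_crossings u (x :: s) d e (+) chain_crossings u (x :: s) e t by [].
rewrite IH.
- rewrite segment_crossings_fan //=; last first.
    by move=> i; rewrite !inE => /or3P[/eqP->|/eqP->|hi] //; apply: sl; rewrite !inE.
  rewrite addbF.
  case: (cross _ _ _ _); case: (fan u x s d); case: (fan u x s e) => /=;
  by case: (chain_crossings _ _ _ _); case: (fan u x s _).
- by move=> z hz; apply: dis; rewrite inE hz orbT.
- by move=> z hz; apply: sl'; rewrite inE hz orbT.
Qed.

Lemma crossC (a b a' b' : R * R) : cross a b a' b' = cross a' b' a b.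
Proof. by rewrite /cross andbC. Qed.

Lemma chain_crossings1 u v d t :
  chain_crossings u [:: v] d t = segment_crossings d t u v.
Proof. by elim: t d => //= e t IH d; rewrite IH addbF crossC. Qed.

(** Straightens the first chain and then the second; each leaves a correction that depends only on
    the ends of the other. *)
Lemma chain_crossings_straight u x s d y t :
  uniq (u :: x :: s) -> uniq (d :: y :: t) ->
  (forall z, z \in d :: y :: t -> z \notin u :: x :: s) ->
  {subset d :: y :: t <= l} -> {subset u :: x :: s <= l} ->
  chain_crossings u (x :: s) d (y :: t) =
  cross (q u) (q (last x s)) (q d) (q (last y t)) (+)
  (fan u x s d (+) fan u x s (last y t)) (+)
  (fan d y t u (+) fan d y t (last x s)).
Proof.
move=> U U' dis sl' sl; rewrite chain_crossings_fan // chain_crossings1.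
have mu : u \in u :: x :: s by rewrite mem_head.
have mv : last x s \in u :: x :: s by rewrite inE mem_last orbT.
have out z : z \in u :: x :: s -> z \notin d :: y :: t.
  by move=> hz; apply/negP => /dis; rewrite hz.
rewrite segment_crossings_fan ?out //.
- rewrite (crossC (q u)); case: (cross _ _ _ _); case: (fan u x s _);
  by case: (fan u x s _); case: (fan d y t _); case: (fan d y t _).
- by apply: contraTneq (U) => {1}->; rewrite cons_uniq mem_last.
- move=> z; rewrite inE => /predU1P[->|]; first exact: sl.
  by rewrite inE => /predU1P[->|]; [apply: sl | apply: sl'].
Qed.

Variables (i1 i2 i3 i4 i5 : T) (c : T -> T -> seq T).
Local Notation vs := [:: i1; i2; i3; i4; i5].
Hypothesis vs_uniq : uniq vs.
Hypothesis chain_neq_nil : forall i j, c i j != [::].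
Hypothesis chain_last : forall i j, last i (c i j) = j.
Hypothesis chain_uniq : {in vs &, forall i j, i != j -> uniq (i :: c i j)}.
Hypothesis chain_sub : {in vs &, forall i j, {subset i :: c i j <= l}}.
Hypothesis chain_disjoint : forall i j k m,
  i \in vs -> j \in vs -> k \in vs -> m \in vs -> uniq [:: i; j; k; m] ->
  forall z, z \in k :: c k m -> z \notin i :: c i j.

(* Replacing one edge of K5 by a straight segment changes the crossing number
   with the three edges of the opposite triangle by an even amount in total,
   since each corner of that triangle is the end of two of its edges. *)
Lemma van_kampen :
  five_crossings i1 i2 i3 i4 i5
    (fun i j k m => chain_crossings i (c i j) k (c k m)).
Proof.
have gen5 : general_position q vs.
  apply: general_position_sub gen => i hi; apply: (chain_sub hi hi).
  exact: mem_head.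
(* [F i j z] is the correction at [z] for straightening the chain from [i] to [j]; [head] and
   [behead] split off its first point, as [fan] wants. *)
pose F i j z := fan i (head i (c i j)) (behead (c i j)) z.
have E i j k m : i \in vs -> j \in vs -> k \in vs -> m \in vs ->
    uniq [:: i; j; k; m] -> chain_crossings i (c i j) k (c k m) =
    cross (q i) (q j) (q k) (q m) (+) (F i j k (+) F i j m) (+)
    (F k m i (+) F k m j).
  move=> hi hj hk hm u.
  have [ij km] : i != j /\ k != m.
    by move: u; rewrite /= !inE !negb_or => /and3P[/and3P[-> _ _] _ /andP[->]].
  have := chain_disjoint hi hj hk hm u.
  have := chain_uniq hi hj ij; have := chain_uniq hk hm km.
  have := chain_sub hi hj; have := chain_sub hk hm.
  have := chain_last i j; have := chain_last k m.
  have := chain_neq_nil i j; have := chain_neq_nil k m.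
  rewrite /F; case: (c i j) => [|x s] //; case: (c k m) => [|y t] // _ _.
  move=> lm lj s1 s2 u1 u2 dis.
  rewrite chain_crossings_straight //.
  by rewrite -[last x s]/(last i (x :: s)) lj -[last y t]/(last k (y :: t)) lm.
move: (vs_uniq); rewrite /= !inE !negb_or !andbT.
move=> /and4P[/and4P[n12 n13 n14 n15] /and3P[n23 n24 n25] /andP[n34 n35] n45].
have U i j k m : i != j -> i != k -> i != m -> j != k -> j != m -> k != m ->
  uniq [:: i; j; k; m].
  by move=> /= h1 h2 h3 h4 h5 h6; rewrite !inE !negb_or h1 h2 h3 h4 h5 h6.
have := five_crossings_odd vs_uniq gen5; rewrite /five_crossings.
rewrite !E ?inE ?eqxx ?orbT ?U // 1?eq_sym //.
rewrite /is_true => <-; have addb_xorb (b b' : bool) : b (+) b' = xorb b b' by case: b; case: b'.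
by rewrite !addb_xorb; btauto.
Qed.

End Chains.

(** * Crossings of short segments, and perturbation into general position *)

Section Perturbation.
Variable R : realFieldType.
Implicit Types (a b c d : R * R) (r : R).

Definition close r a b : bool :=
  (`|a.1 - b.1| <= r) && (`|a.2 - b.2| <= r).

Lemma close_refl r a : 0 <= r -> close r a a.
Proof. by rewrite /close !subrr normr0 andbb. Qed.

Lemma close_sym r a b : close r a b = close r b a.
Proof. by rewrite /close distrC (distrC a.2). Qed.

Lemma close_trans r r' a b c : close r a b -> close r' b c -> close (r + r') a c.
Proof.
move=> /andP[h1 h2] /andP[h3 h4]; apply/andP; split.
  by rewrite (le_trans (ler_distD b.1 _ _)) // lerD.
by rewrite (le_trans (ler_distD b.2 _ _)) // lerD.
Qed.

Lemma close_le r r' a b : r <= r' -> close r a b -> close r' a b.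
Proof. by move=> rr' /andP[h1 h2]; rewrite /close !(le_trans _ rr'). Qed.

Lemma cross_weights a b c d : cross a b c d ->
  exists w : R * R * (R * R),
    [/\ [/\ 0 <= w.1.1, 0 <= w.1.2, 0 <= w.2.1 & 0 <= w.2.2],
        0 < w.1.1 + w.1.2, w.1.1 + w.1.2 = w.2.1 + w.2.2,
        w.1.1 * a.1 + w.1.2 * b.1 = w.2.1 * c.1 + w.2.2 * d.1 &
        w.1.1 * a.2 + w.1.2 * b.2 = w.2.1 * c.2 + w.2.2 * d.2].
Proof.
rewrite /cross /ccw => /andP[].
set x := orient a b c; set y := orient a b d.
set z := orient c d a; set t := orient c d b.
have e0 : t - z = x - y by rewrite /x /y /z /t /orient; ring.
have e1 : t * a.1 - z * b.1 = x * d.1 - y * c.1.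
  by rewrite /x /y /z /t /orient; ring.
have e2 : t * a.2 - z * b.2 = x * d.2 - y * c.2.
  by rewrite /x /y /z /t /orient; ring.
case: (ltP 0 x) => hx; case: (ltP 0 y) => hy // _;
case: (ltP 0 z) => hz; case: (ltP 0 t) => ht // _.
- by exists ((t, - z), (- y, x)); split => //=; try split; lra.
- by exists ((t, - z), (- y, x)); split => //=; try split; lra.
- by exists ((- t, z), (y, - x)); split => //=; try split; lra.
- by exists ((- t, z), (y, - x)); split => //=; try split; lra.
Qed.

(** In one coordinate: the common mean lies within [r] of [x] and within [r] of [z]. *)
Lemma weights_close (w1 w2 w3 w4 x y z t r : R) :
  0 <= w1 -> 0 <= w2 -> 0 <= w3 -> 0 <= w4 -> 0 < w1 + w2 ->
  w1 + w2 = w3 + w4 -> w1 * x + w2 * y = w3 * z + w4 * t ->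
  `|x - y| <= r -> `|z - t| <= r -> `|x - z| <= 2 * r.
Proof.
move=> h1 h2 h3 h4 h5 e1 e2 hx hz.
have e3 : (w1 + w2) * (x - z) = w2 * (x - y) - w4 * (z - t).
  have : (w1 + w2) * z = (w3 + w4) * z by rewrite e1.
  by move: e2; rewrite !mulrDl !mulrBr; lra.
have r0 : 0 <= r by apply: le_trans hx.
rewrite -(ler_pM2l h5) -{1}(gtr0_norm h5) -normrM e3.
rewrite (le_trans (ler_normB _ _)) // !normrM (ger0_norm h2) (ger0_norm h4).
have := ler_wpM2l h2 hx; have := ler_wpM2l h4 hz.
have := mulr_ge0 h1 r0; have := mulr_ge0 h3 r0.
have : (w1 + w2) * r = (w3 + w4) * r by rewrite e1.
by rewrite !mulrDl; lra.
Qed.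

Lemma cross_close r a b c d :
  close r a b -> close r c d -> cross a b c d -> close (2 * r) a c.
Proof.
move=> /andP[h1 h2] /andP[h3 h4].
move=> /cross_weights[[[w1 w2] [w3 w4]] /= [[? ? ? ?] ? ? e1 e2]].
by apply/andP; split; [apply: weights_close e1 _ _ | apply: weights_close e2 _ _].
Qed.

(** The candidates [r / (i + 2)] for [i < size P] are distinct and outnumber the roots. *)
Lemma poly_nonroot (P : {poly R}) r :
  P != 0 -> 0 < r -> exists2 s, 0 < s < r & ~~ root P s.
Proof.
move=> P0 r0; pose rs := [seq r / (i.+2)%:R | i <- iota 0 (size P)].
have [/hasP[s]|/hasPn h] := boolP (has (fun s => ~~ root P s) rs).
  case/mapP => i _ -> h; exists (r / (i.+2)%:R) => //.
  by rewrite divr_gt0 ?ltr0n //= ltr_pdivrMr ?ltr0n // ltr_pMr // ltr1n.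
have := @max_poly_roots _ P rs P0; rewrite size_map size_iota ltnn => /(_ _ _) H.
suff : false by []; apply: H.
  by apply/allP => s /h; rewrite negbK.
rewrite map_inj_uniq ?iota_uniq // => i j /(mulfI (lt0r_neq0 r0)) /invr_inj.
by move/eqP; rewrite eqr_nat => /eqP[].
Qed.

(* Points are moved along the moment curve, along which any three points are
   in general position, so only finitely many amounts are bad. *)
Lemma exists_general_position (T : eqType) (pos : T -> R * R) (l : seq T) r :
  0 < r -> exists q : T -> R * R,
    general_position q l /\ {in l, forall t, close r (q t) (pos t)}.
Proof.
move=> r0; pose k t : R := (index t l)%:R.
pose q s t := ((pos t).1 + s * k t, (pos t).2 + s * k t ^+ 2).
have kinj i j : i \in l -> j \in l -> i != j -> k j - k i != 0.
  move=> hi hj; apply: contraNneq => /eqP; rewrite subr_eq0 eqr_nat => /eqP h.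
  by rewrite -(nth_index i hi) -h nth_index.
(* The orientation of a moved triple is a quadratic polynomial in [s]. Its leading coefficient [V]
   is the Vandermonde determinant of the parameters [k], which are distinct because they are indices
   in [l]. *)
pose B i j m := ((pos j).1 - (pos i).1) * (k m ^+ 2 - k i ^+ 2) +
  (k j - k i) * ((pos m).2 - (pos i).2) - ((pos j).2 - (pos i).2) * (k m - k i)
  - (k j ^+ 2 - k i ^+ 2) * ((pos m).1 - (pos i).1).
pose V i j m := (k j - k i) * (k m - k i) * (k m - k j).
pose P i j m : {poly R} :=
  (orient (pos i) (pos j) (pos m))%:P + (B i j m)%:P * 'X + (V i j m)%:P * 'X^2.
have Pe i j m s : (P i j m).[s] = orient (q s i) (q s j) (q s m).
  by rewrite /P !hornerE /orient /q /= /B /V; ring.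
have Pn i j m : i \in l -> j \in l -> m \in l ->
    i != j -> i != m -> j != m -> P i j m != 0.
  move=> hi hj hm ij im jm; apply/eqP => /(congr1 (fun p : {poly R} => p`_2)).
  rewrite /P !coefD !coefCM coefC coefX coefXn /= coef0 mulr0 mulr1 !add0r.
  by apply/eqP; rewrite !mulf_neq0 // kinj.
pose Q := \prod_(i <- l) \prod_(j <- l) \prod_(m <- l)
  (if P i j m == 0 then 1 else P i j m).
have Q0 : Q != 0.
  rewrite prodf_seq_neq0; apply/allP => i _; rewrite /= prodf_seq_neq0.
  apply/allP => j _; rewrite /= prodf_seq_neq0; apply/allP => m _ /=.
  by case: ifPn => // _; apply: oner_neq0.
(* [M] bounds [k t] and its square, so [s < r / M] moves each coordinate by at most [r]. *)
pose M : R := 1 + (size l)%:R ^+ 2.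
have M0 : 0 < M by rewrite ltr_wpDr ?exprn_ge0.
have [s /andP[s0 sr] Qs] := poly_nonroot Q0 (divr_gt0 r0 M0).
exists (q s); split.
  move=> i j m hi hj hm ij im jm; rewrite -Pe; apply: contraNneq Qs => h.
  have Pd : P i j m %| Q.
    rewrite /Q (big_rem i) //= (big_rem j) //= (big_rem m) //=.
    by rewrite (negbTE (Pn _ _ _ hi hj hm ij im jm)) -!mulrA dvdp_mulr.
  by rewrite -dvdp_XsubCl; apply: dvdp_trans Pd; rewrite dvdp_XsubCl; apply/rootP.
move=> t ht; have kM : k t <= M /\ k t ^+ 2 <= M.
  have h : k t <= (size l)%:R by rewrite ler_nat ltnW // index_mem.
  have h0 : 0 <= k t by rewrite ler0n.
  by rewrite /M; split; nra.
have k0 : 0 <= k t by rewrite ler0n.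
have bound x : 0 <= x -> x <= M -> `|s * x| <= r.
  move=> x0 xM; rewrite ger0_norm ?mulr_ge0 // ltW //.
  rewrite ltr_pdivlMr // in sr; apply: le_lt_trans sr.
  by rewrite ler_wpM2l // ltW.
have addKl x y : x + y - x = y :> R by rewrite addrC addKr.
by rewrite /close /q /= !addKl !bound ?exprn_ge0 //; case: kM.
Qed.

End Perturbation.

(** * Realizable graphs *)

Section Realizable.
Variables (R : realFieldType) (V : finType).
Implicit Types (E : rel V) (p : V -> R * R) (c : V -> V -> seq (R * R)).

(* A metric substitute for planarity: edges are drawn as chains of arbitrarily
   small steps, with a distance between independent edges that does not depend
   on the step. Unlike drawings by arcs, this is closed under contraction, as
   chains can simply be concatenated. *)
Definition realizable E : Prop := exists p (r : R), 0 < r /\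
  forall eta : R, 0 < eta -> exists c,
    (forall u v, E u v -> path (close eta) (p u) (c u v) /\ last (p u) (c u v) = p v) /\
    (forall u v x y, E u v -> E x y -> u != x -> u != y -> v != x -> v != y ->
      forall a b, a \in p u :: c u v -> b \in p x :: c x y -> ~~ close r a b).

Lemma chain_crossings0 (T : eqType) (q : T -> R * R) (r : R) x s d t :
  path (fun i j => close r (q i) (q j)) x s ->
  path (fun i j => close r (q i) (q j)) d t ->
  (forall i j, i \in x :: s -> j \in d :: t -> ~~ close (2 * r) (q i) (q j)) ->
  chain_crossings q x s d t = false.
Proof.
move=> ps; elim: t d => //= e t IH d /andP[de pt] far.
rewrite {}IH //; last first.
  by move=> i j hi hj; apply: far; rewrite // inE hj orbT.
rewrite addbF; elim: s x ps far => //= y s IH x /andP[xy ps] far.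
rewrite {}IH //; last first.
  by move=> i j hi; apply: far; rewrite inE hi orbT.
rewrite addbF; apply/negP => /(cross_close xy de).
by apply/negP/far; rewrite mem_head.
Qed.

(** Take chains of step [r / 16] and move all their points by at most [r / 16] into general
    position. Steps are then at most [3 r / 16], so a crossing would bring independent chains within
    [6 r / 16], hence the original ones within [r / 2]. Without crossings the parity of [van_kampen]
    would be even. *)
Lemma K5_not_realizable E (vs : seq V) :
  uniq vs -> size vs = 5%N -> {in vs &, forall u v, u != v -> E u v} ->
  ~ realizable E.
Proof.
case: vs => [|v1 [|v2 [|v3 [|v4 [|v5 [|? ?]]]]]] //.
set vs := [:: v1; v2; v3; v4; v5] => vs_uniq _ EK [p [r [r0 H]]].
have e0 : 0 < r / 16 by rewrite divr_gt0.
have [c [c_path c_far]] := H _ e0.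
(* Chain points are labelled by edge and position, so that labels stay distinct where points
   coincide. *)
pose T : eqType := (V + V * V * nat)%type.
pose pos (t : T) : R * R :=
  match t with inl v => p v | inr (i, j, k) => nth (p i) (c i j) k end.
(* The extra last label [inl j] repeats the position of the final chain point, so that all chains
   into [j] share their end label. *)
pose ch i j : seq T :=
  rcons [seq inr (i, j, k) | k <- iota 0 (size (c i j))] (inl j).
pose C (i j : T) : seq T :=
  match i, j with inl i, inl j => ch i j | _, _ => [:: j] end.
pose ws : seq T := map inl vs.
have wsP (t : T) : t \in ws -> exists2 i, i \in vs & t = inl i by case/mapP => i; exists i.
pose l := flatten [seq i :: C i j | i <- ws, j <- ws].
have [q [gen qpos]] := exists_general_position pos l e0.
have Cin (t : T) i j : t \in inl i :: ch i j =
    match t with inl v => (v == i) || (v == j)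
    | inr (a, b, k) => [&& a == i, b == j & (k < size (c i j))%N] end.
  rewrite inE mem_rcons inE; case: t => [v|[[a b] k]] /=.
    rewrite !(inj_eq (@inl_inj _ _)) orbA; apply/orb_idr.
    by case/mapP.
  apply/mapP/and3P => [[k'] + [-> -> ->]|[/eqP-> /eqP-> hk]].
    by rewrite mem_iota add0n => /andP[_ ?].
  by exists k => //; rewrite mem_iota.
have sub : {in ws &, forall i j, {subset i :: C i j <= l}}.
  move=> i j hi hj t ht; apply/flattenP; exists (i :: C i j) => //.
  by apply/allpairsP; exists (i, j).
have map_ch i j : map pos (ch i j) = rcons (c i j) (p j).
  rewrite map_rcons -map_comp; congr rcons.
  apply: (@eq_from_nth _ (p i)); rewrite size_map size_iota // => k hk.
  by rewrite (nth_map 0%N) ?size_iota // nth_iota.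
have path_ch i j : i \in vs -> j \in vs -> i != j ->
    path (fun s t => close (3 * (r / 16)) (q s) (q t)) (inl i) (ch i j).
  move=> hi hj ij; have [hp hl] := c_path _ _ (EK _ _ hi hj ij).
  have : path (relpre pos (close (r / 16))) (inl i) (ch i j).
    by rewrite -path_map map_ch rcons_path hp /= hl close_refl // ltW.
  apply: (@sub_in_path _ (mem l)); last first.
    by apply/allP => t ht; apply: (sub (inl i) (inl j)) => //; rewrite map_f.
  move=> s t hs ht /= h; have := close_trans (qpos _ hs) h.
  have := qpos _ ht; rewrite close_sym => h1 h2.
  by apply: close_le (close_trans h2 h1); lra.
have := van_kampen gen (i1 := inl v1) (i2 := inl v2) (i3 := inl v3)
  (i4 := inl v4) (i5 := inl v5) (c := C).
rewrite -/ws => /(_ _ _ _ _ _ _) VK.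
have {VK} : is_true (five_crossings (inl v1 : T) (inl v2) (inl v3) (inl v4) (inl v5)
    (fun i j k m => chain_crossings q i (C i j) k (C k m))).
  apply: VK.
  - by rewrite -[[:: _; _; _; _; _]]/ws (map_inj_uniq (@inl_inj _ _)).
  - by case=> [i|[[? ?] ?]] [j|[[? ?] ?]] //; rewrite /C /ch; case: map.
  - by case=> [i|[[? ?] ?]] [j|[[? ?] ?]] //; rewrite /C /ch last_rcons.
  - move=> _ _ /wsP[i hi ->] /wsP[j hj ->]; rewrite (inj_eq (@inl_inj _ _)) => ij.
    rewrite /= mem_rcons inE negb_or (inj_eq (@inl_inj _ _)) ij rcons_uniq.
    rewrite map_inj_uniq ?iota_uniq; last by move=> ? ? [].
    by rewrite andbT; apply/andP; split; apply/negP => /mapP[].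
  - exact: sub.
  - move=> _ _ _ _ /wsP[i hi ->] /wsP[j hj ->] /wsP[k hk ->] /wsP[m hm ->].
    rewrite -[[:: _; _; _; _]]/(map inl [:: i; j; k; m]).
    rewrite (map_inj_uniq (@inl_inj _ _)) /= !inE !negb_or.
    move=> /and4P[/and3P[ij ik im] /andP[jk jm] km _] t.
    rewrite !Cin; case: t => [v /orP[]/eqP->|[[a b] n] /and3P[/eqP-> _ _]].
    + by rewrite negb_or !(eq_sym k) ik jk.
    + by rewrite negb_or !(eq_sym m) im jm.
    + by rewrite eq_sym (negbTE ik).
have X i j k m : i \in vs -> j \in vs -> k \in vs -> m \in vs ->
    uniq [:: i; j; k; m] ->
    chain_crossings q (inl i) (C (inl i) (inl j)) (inl k) (C (inl k) (inl m)) = false.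
  move=> hi hj hk hm; rewrite /= !inE !negb_or.
  move=> /and4P[/and3P[ij ik im] /andP[jk jm] km _].
  apply: (@chain_crossings0 _ _ (3 * (r / 16))); rewrite ?path_ch // => s t hs ht.
  have hsl : s \in l by apply: (sub (inl i) (inl j)) => //; rewrite map_f.
  have htl : t \in l by apply: (sub (inl k) (inl m)) => //; rewrite map_f.
  apply/negP => h; have far := c_far _ _ _ _ (EK _ _ hi hj ij) (EK _ _ hk hm km).
  have mem_pos a b z : a \in vs -> b \in vs -> a != b -> z \in inl a :: ch a b ->
      pos z \in p a :: c a b.
    move=> ha hb ab; rewrite Cin; case: z => [v /orP[]/eqP->|[[x y] n]].
    + exact: mem_head.
    + by rewrite /= -(proj2 (c_path _ _ (EK _ _ ha hb ab))) mem_last.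
    + by move=> /and3P[/eqP-> /eqP-> hn]; rewrite inE mem_nth ?orbT.
  have := far ik im jk jm _ _ (mem_pos _ _ _ hi hj ij hs) (mem_pos _ _ _ hk hm km ht).
  apply/negP/negPn.
  have := qpos _ hsl; rewrite close_sym => h1.
  have := close_trans (close_trans h1 h) (qpos _ htl).
  by apply: close_le; lra.
move: (vs_uniq); rewrite /= !inE !negb_or !andbT.
move=> /and4P[/and4P[n12 n13 n14 n15] /and3P[n23 n24 n25] /andP[n34 n35] n45].
have U (i j k m : V) : i != j -> i != k -> i != m -> j != k -> j != m ->
    k != m ->
  uniq [:: i; j; k; m].
  by move=> /= h1 h2 h3 h4 h5 h6; rewrite !inE !negb_or h1 h2 h3 h4 h5 h6.
by rewrite /five_crossings !X ?inE ?eqxx ?orbT ?U // eq_sym.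
Qed.

End Realizable.

(** * Minors and the edge bound *)

Section Minors.
Variable V : finType.
Implicit Types (E F : rel V) (S : {set V}) (u v x y : V).

Definition nbrs E x : {set V} := [set y | E x y].

Definition arcs E : nat := #|[set z : V * V | E z.1 z.2]|.

(** Merges [v] into [u] on the same vertex type: [v] remains as an isolated vertex, and a set [S] of
    live vertices does the counting in [mader]. *)
Definition contract E u v : rel V := fun x y =>
  [&& x != y, x != v, y != v & [|| E x y, (x == u) && E v y | (y == u) && E v x]].

Definition delete E u v : rel V := fun x y =>
  E x y && ~~ ((x == u) && (y == v) || (x == v) && (y == u)).

Lemma arcs_sum E : arcs E = (\sum_x #|nbrs E x|)%N.
Proof.
rewrite /arcs -sum1_card.
under [in RHS]eq_bigr do rewrite -sum1_card.
rewrite pair_big_dep /=; apply: eq_bigl => z; by rewrite !inE.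
Qed.

Lemma contract_sym E u v : symmetric E -> symmetric (contract E u v).
Proof.
move=> sE x y; rewrite /contract (eq_sym x y) (sE x y).
by case: (y != x); case: (x != v); case: (y != v); case: (E y x) => //=; rewrite orbC.
Qed.

Lemma contract_irr E u v : irreflexive (contract E u v).
Proof. by move=> x; rewrite /contract eqxx. Qed.

Lemma delete_sym E u v : symmetric E -> symmetric (delete E u v).
Proof. by move=> sE x y; rewrite /delete sE orbC (andbC (x == u)) (andbC (x == v)). Qed.

Lemma arcs_delete E u v : (arcs E <= arcs (delete E u v) + 2)%N.
Proof.
rewrite /arcs; set A := [set z | E z.1 z.2].
have -> : [set z : V * V | delete E u v z.1 z.2] = A :\ (u, v) :\ (v, u).
  apply/setP => -[x y]; rewrite !inE /delete !xpair_eqE /=.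
  by case: (E x y) => /=; rewrite ?andbF // !andbT negb_or andbC.
have := cardsD1 (u, v) A; have := cardsD1 (v, u) (A :\ (u, v)).
have := leq_b1 ((u, v) \in A); have := leq_b1 ((v, u) \in A :\ (u, v)); lia.
Qed.

Lemma arcs_delete_lt E u v : E u v -> (arcs (delete E u v) < arcs E)%N.
Proof.
move=> uv; apply: proper_card; apply/properP; split.
  by apply/fintype.subsetP => z; rewrite !inE => /andP[].
by exists (u, v); rewrite !inE //= /delete !eqxx andbF.
Qed.

(** What is lost is the edge [u v] itself and, for each common neighbour, one of two edges that
    become parallel; [arcs] counts each edge twice. *)
Lemma arcs_contract E u v : symmetric E -> irreflexive E -> E u v ->
  (arcs E <= arcs (contract E u v) + 2 + 2 * #|nbrs E u :&: nbrs E v|)%N.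
Proof.
move=> sE iE uv; rewrite !arcs_sum.
have nuv : u != v by apply: contraTneq uv => ->; rewrite iE.
set C := nbrs E u :&: nbrs E v.
rewrite (bigD1 u) //= [X in (X <= _)%N](_ : _ = #|nbrs E u| + (#|nbrs E v| +
  \sum_(i | (i != u) && (i != v)) #|nbrs E i|))%N; last first.
  by congr addn; rewrite (bigD1 v) //= eq_sym.
rewrite [in leqRHS](bigD1 u) //= [X in (_ + X + _ + _)%N](_ : _ = #|nbrs (contract E u v) v| +
  \sum_(i | (i != u) && (i != v)) #|nbrs (contract E u v) i|)%N; last first.
  by rewrite (bigD1 v) //= eq_sym.
(* A vertex other than [u] and [v] loses a neighbour only if it is adjacent to both. *)
have rest : (\sum_(i | (i != u) && (i != v)) #|nbrs E i| <=
   \sum_(i | (i != u) && (i != v)) #|nbrs (contract E u v) i| + #|C|)%N.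
  have -> : #|C| = (\sum_(i | (i != u) && (i != v)) (i \in C))%N.
    rewrite -sum1_card big_mkcond [RHS]big_mkcond /=; apply: eq_bigr => i _.
    have [->|iu] := eqVneq i u; first by rewrite !inE iE.
    by have [->|iv] := eqVneq i v; [rewrite !inE iE andbF | case: (_ \in _)].
  rewrite -big_split; apply: leq_sum => i /andP[iu iv].
  have [vi|nvi] := boolP (E v i); last first.
    apply: leq_trans (leq_addr _ _); apply: subset_leq_card.
    apply/fintype.subsetP => y; rewrite !inE /contract iv => iy.
    have -> : i != y by apply: contraTneq iy => ->; rewrite iE.
    have -> : y != v by apply: contraTneq iy => ->; rewrite sE.
    by rewrite iy.
  have sub : u |: nbrs E i :\ v \subset nbrs (contract E u v) i.
    apply/fintype.subsetP => y; rewrite !inE /contract iv.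
    case/predU1P => [->|/andP[yv iy]]; first by rewrite iu nuv eqxx vi !orbT.
    by rewrite yv iy !andbT; apply: contraTneq iy => ->; rewrite iE.
  have := subset_leq_card sub; rewrite cardsU1 !inE nuv /= (sE u i).
  have := cardsD1 v (nbrs E i); rewrite !inE sE vi (sE i u).
  by case: (E u i) => /=; lia.
have nu : (#|nbrs E u| + #|nbrs E v| <= #|nbrs (contract E u v) u| + #|C| + 2)%N.
  have sub : (nbrs E u :\ v) :|: (nbrs E v :\ u) \subset nbrs (contract E u v) u.
    apply/fintype.subsetP => y; rewrite !inE /contract nuv eqxx (eq_sym u y) /=.
    case/orP => /andP[yv uy]; rewrite yv uy ?orbT /= andbT.
      by apply: contraTneq uy => ->; rewrite iE.
    by apply: contraTneq uy => ->; rewrite iE.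
  have := subset_leq_card sub; rewrite cardsU.
  have : (#|(nbrs E u :\ v) :&: (nbrs E v :\ u)| <= #|C|)%N.
    apply: subset_leq_card; apply/fintype.subsetP => y; rewrite !inE.
    by move=> /andP[/andP[_ ->] /andP[_ ->]].
  have := cardsD1 v (nbrs E u); have := cardsD1 u (nbrs E v).
  rewrite !inE uv sE uv.
  have := subset_leq_card (finset.subsetIl (nbrs E u :\ v) (nbrs E v :\ u)).
  by lia.
by lia.
Qed.

End Minors.

(** * Mader's edge bound for a minor-closed property that excludes K5 *)

Section Mader.
Variables (V : finType) (P : rel V -> Prop).
Implicit Types (E F : rel V) (S : {set V}) (u v x y : V).
Hypothesis P_delete : forall E u v, P E -> P (delete E u v).
Hypothesis P_contract : forall E u v,
  symmetric E -> irreflexive E -> E u v -> P E -> P (contract E u v).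
Hypothesis P_K5 : forall E (vs : seq V),
  uniq vs -> size vs = 5%N -> {in vs &, forall u v, u != v -> E u v} -> ~ P E.

(** A deletion removes one or two arcs, so the count cannot jump over both [k] and [k.+1]. *)
Lemma arcs_trim E k : symmetric E -> P E -> (k <= arcs E)%N ->
  exists F, [/\ symmetric F, P F, subrel F E & (k <= arcs F <= k.+1)%N].
Proof.
have [n] := ubnP (arcs E); elim: n E => // n IH E hn sE PE hk.
have [h|h] := leqP (arcs E) k.+1; first by exists E; split; rewrite ?hk.
have [z hz] : exists z : V * V, E z.1 z.2.
  have /card_gt0P[z] : (0 < arcs E)%N by lia.
  by rewrite inE; exists z.
have := arcs_delete E z.1 z.2; have := arcs_delete_lt hz => h1 h2.
have [||F [sF PF FE hF]] := IH (delete E z.1 z.2) _ (delete_sym _ _ sE) (P_delete _ _ PE).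
- by lia.
- by lia.
by exists F; split => // x y /FE /andP[].
Qed.

Lemma clique_K5 E v (A : {set V}) : symmetric E -> P E ->
  #|A| = 4%N -> v \notin A -> {in A, forall x, E v x} ->
  {in A &, forall x y, x != y -> E x y} -> False.
Proof.
move=> sE PE A4 vA hv hA; apply: (P_K5 (vs := v :: enum A)) PE.
- by rewrite /= mem_enum vA enum_uniq.
- by rewrite /= -cardE A4.
move=> x y; rewrite !inE !mem_enum.
move=> /predU1P[->|hx] /predU1P[->|hy]; rewrite ?eqxx //; try by move=> _; apply: hv.
  by move=> _; rewrite sE; apply: hv.
exact: hA.
Qed.

(** There are at least four neighbours. If there are four, they form K5 with [v]. If there are five,
    the missing pairs among them form a matching: with at most one such pair, leaving out a vertex
    gives K5; with two, [a b] and [c d], contracting [a c] makes [a] adjacent to [b] through [c],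
    and K5 appears. *)
Lemma dense_neighbourhood E v : symmetric E -> irreflexive E -> P E ->
  (0 < #|nbrs E v| <= 5)%N ->
  {in nbrs E v, forall x, (2 < #|nbrs E v :&: nbrs E x|)%N} -> False.
Proof.
move=> sE iE PE /andP[N0 N5] dense.
have vN : v \notin nbrs E v by rewrite inE iE.
have NE : {in nbrs E v, forall x, E v x} by move=> x; rewrite inE.
move: (nbrs E v) N0 N5 dense vN NE => N N0 N5 dense vN NE.
have sub x : x \in N -> N :&: nbrs E x \subset N :\ x.
  move=> hx; apply/fintype.subsetP => y; rewrite !inE => /andP[-> xy]; rewrite andbT.
  by apply: contraTneq xy => ->; rewrite iE.
have card x : x \in N -> #|N :\ x| = #|N|.-1.
  by move=> hx; rewrite (cardsD1 x N) hx.
(* For five neighbours this says that no vertex of [N] belongs to two missing pairs. *)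
have one_missing x y z : x \in N -> y \in N -> z \in N -> x != y -> y != z ->
    x != z -> ~~ E x y -> ~~ E x z -> False.
  move=> hx hy hz xy yz xz nxy nxz; have := dense x hx.
  have /subset_leq_card : N :&: nbrs E x \subset N :\ x :\ y :\ z.
    apply/fintype.subsetP => t ht; move/fintype.subsetP: (sub x hx) => /(_ t ht).
    move: ht; rewrite !inE => /andP[_ xt] ->; rewrite !andbT.
    by apply/andP; split; apply: contraTneq xt => ->.
  have := cardsD1 z (N :\ x :\ y); have := cardsD1 y (N :\ x).
  rewrite (card x hx) !inE hy hz (eq_sym z) (eq_sym y x) yz xy (eq_sym z) xz /=.
  by lia.
have [x0 hx0] := card_gt0P N0.
have N4 : (4 <= #|N|)%N.
  by have := subset_leq_card (sub _ hx0); have := dense _ hx0; rewrite card //; lia.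
have hv (A : {set V}) : A \subset N -> {in A, forall x, E v x}.
  by move=> /fintype.subsetP AN x /AN; apply: NE.
have [n4|n4] := eqVneq #|N| 4%N.
  apply: (clique_K5 sE PE n4 vN (hv _ (subxx _))) => x y hx hy xy.
  have /eqP e : N :&: nbrs E x == N :\ x.
    by rewrite eqEcard sub // card // n4; apply: dense.
  have : y \in N :\ x by rewrite !inE eq_sym xy hy.
  by rewrite -e !inE => /andP[].
have {N5 N4}n5 : #|N| = 5%N by lia.
have [/existsP[a /andP[aN /existsP[b /and3P[bN ab nab]]]]|h] := boolP
    [exists a, (a \in N) && [exists b, [&& b \in N, a != b & ~~ E a b]]]; last first.
  have adj x y : x \in N -> y \in N -> x != y -> E x y.
    move=> hx hy xy; apply: contraNT h => nxy; apply/existsP; exists x.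
    by rewrite hx; apply/existsP; exists y; rewrite hy xy.
  apply: (@clique_K5 E v (N :\ x0)) => //.
  - by rewrite card // n5.
  - by rewrite !inE (negbTE vN) andbF.
  - exact: hv (finset.subsetDl _ _).
  - by move=> x y /setD1P[_ hx] /setD1P[_ hy]; apply: adj.
have nba : ~~ E b a by rewrite sE.
have adja x : x \in N -> x != a -> x != b -> E a x.
  move=> hx xa xb; apply/negPn/negP => nax.
  by apply: (one_missing a b x) => //; rewrite eq_sym.
have adjb x : x \in N -> x != a -> x != b -> E b x.
  move=> hx xa xb; apply/negPn/negP => nax.
  by apply: (one_missing b a x) => //; rewrite eq_sym.
have N'3 : #|N :\ a :\ b| = 3%N.
  have := cardsD1 b (N :\ a); rewrite card // n5 !inE bN eq_sym ab /=; lia.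
have [/existsP[c /andP[cN /existsP[d /and3P[dN cd ncd]]]]|h] := boolP
    [exists c, (c \in N :\ a :\ b) &&
    [exists d, [&& d \in N :\ a :\ b, c != d & ~~ E c d]]]; last first.
  have adj x y : x \in N :\ a :\ b -> y \in N :\ a :\ b -> x != y -> E x y.
    move=> hx hy xy; apply: contraNT h => nxy; apply/existsP; exists x.
    by rewrite hx; apply/existsP; exists y; rewrite hy xy.
  apply: (@clique_K5 E v (N :\ b)) => //.
  - by rewrite card // n5.
  - by rewrite !inE (negbTE vN) andbF.
  - exact: hv (finset.subsetDl _ _).
  - move=> x y /setD1P[xb hx] /setD1P[yb hy] xy.
    have [xa|xa] := eqVneq x a.
      by rewrite xa; apply: adja; rewrite // -xa eq_sym.
    have [ya|ya] := eqVneq y a; first by rewrite ya sE; apply: adja.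
    by apply: adj; rewrite // !inE ?xa ?ya ?xb ?yb.
have [cb ca cN'] : [/\ c != b, c != a & c \in N] by move: cN; rewrite !inE => /and3P[].
have [db da dN'] : [/\ d != b, d != a & d \in N] by move: dN; rewrite !inE => /and3P[].
have Eac : E a c by apply: adja.
apply: (@clique_K5 (contract E a c) v (N :\ c)).
- exact: contract_sym.
- exact: P_contract.
- by rewrite card // n5.
- by rewrite !inE (negbTE vN) andbF.
- move=> x /setD1P[xc xN]; rewrite /contract xc.
  have vx := NE x xN.
  rewrite vx !andbT; apply/andP; split.
    by apply: contraTneq vx => ->; rewrite iE.
  by apply: contraTneq cN' => <-.
move=> x y /setD1P[xc xN] /setD1P[yc yN] xy; rewrite /contract xy xc yc /=.
have [xa|xa] := eqVneq x a.
  have [yb|yb] := eqVneq y b; first by rewrite yb (sE c b) (adjb c) //= !orbT.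
  by rewrite xa adja // -xa eq_sym.
have [ya|ya] := eqVneq y a.
  have [xb|xb] := eqVneq x b; first by rewrite xb (sE c b) (adjb c) //= !orbT.
  by rewrite ya sE adja.
have [xb|xb] := eqVneq x b; first by rewrite xb adjb // -xb eq_sym.
have [yb|yb] := eqVneq y b; first by rewrite yb sE adjb.
apply/orP; left; apply/negPn/negP => nxy.
(* Outside [a], [b], [c] only two vertices of [N] are left, one of them [d], and [d] already misses
   [c]. *)
have only z t : z \in N -> t \in N -> z != a -> z != b -> t != a -> t != b ->
    z != c -> t != c -> z != t -> z = d \/ t = d.
  move=> zN tN za zb ta tb zc tc zt.
  have [->|zd] := eqVneq z d; first by left.
  have [->|td] := eqVneq t d; first by right.
  have : (size [:: z; t; c; d] <= size (enum (N :\ a :\ b)))%N.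
    apply: uniq_leq_size.
      by rewrite /= !inE !negb_or zt zc zd tc td cd.
    move=> w; rewrite mem_enum !inE => /or4P[] /eqP->;
    by rewrite ?za ?zb ?zN ?ta ?tb ?tN ?ca ?cb ?cN' ?da ?db ?dN'.
  by rewrite -cardE N'3.
have [xd|yd] := only x y xN yN xa xb ya yb xc yc xy.
  move: xy nxy; rewrite xd => dy ndy.
  by apply: (one_missing d c y); rewrite // 1?eq_sym // sE.
move: xy nxy; rewrite yd => dx ndx.
by apply: (one_missing d c x); rewrite // 1?eq_sym // sE.
Qed.

Lemma arcs_card E S : irreflexive E -> (forall u v, E u v -> (u \in S) && (v \in S)) ->
  (arcs E <= #|S| * #|S|.-1)%N.
Proof.
move=> iE ES; have out x : x \notin S -> #|nbrs E x| = 0%N.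
  move=> xS; apply/eqP; rewrite cards_eq0; apply/eqP/setP => y; rewrite !inE.
  by apply/negbTE; apply: contra xS => /ES/andP[].
rewrite arcs_sum (bigID (mem S)) /= addnC big1 // add0n.
rewrite -sum_nat_const; apply: leq_sum => x xS.
have -> : #|S|.-1 = #|S :\ x| by rewrite (cardsD1 x S) xS.
apply: subset_leq_card; apply/fintype.subsetP => y.
rewrite !inE => xy; have /andP[_ ->] := ES _ _ xy; rewrite andbT.
by apply: contraTneq xy => ->; rewrite iE.
Qed.

(** In terms of edges this is [e <= 3 |S| - 6]. A counterexample trimmed to the threshold has
    average degree below 6, hence a vertex [v] of degree at most 5. If [v] is isolated it is
    dropped; otherwise [dense_neighbourhood] yields an edge at [v] in at most two triangles, which
    is contracted. Either way the smaller graph is still too dense. *)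
Lemma mader E S : symmetric E -> irreflexive E ->
  (forall u v, E u v -> (u \in S) && (v \in S)) -> (2 < #|S|)%N -> P E ->
  (arcs E + 10 < 6 * #|S|)%N.
Proof.
have [n] := ubnP #|S|; elim: n E S => // n IH E S hn sE iE ES S3 PE.
rewrite ltnNge; apply/negP => dense.
have [|F [sF PF FE hF]] := @arcs_trim E (6 * #|S| - 10)%N sE PE; first by lia.
have iF : irreflexive F by move=> x; apply/negP => /FE; rewrite iE.
have {ES FE}FS u v : F u v -> (u \in S) && (v \in S) by move=> /FE/ES.
(* Three vertices carry at most 6 arcs, fewer than [6 * 3 - 10]. *)
have S4 : (3 < #|S|)%N.
  have := arcs_card iF FS; move: S3 hF; case: #|S| => [|[|[|[|k]]]] //; lia.
have [v vS v5] : exists2 v, v \in S & (#|nbrs F v| <= 5)%N.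
  apply/exists_inP; apply: contraTT (_ : arcs F < 6 * #|S|)%N; last lia.
  rewrite negb_exists_in => /forall_inP h; rewrite -leqNgt mulnC -sum_nat_const.
  rewrite arcs_sum [leqRHS](bigID (mem S)) /=; apply: leq_trans (leq_addr _ _).
  by apply: leq_sum => x /h; rewrite -ltnNge.
have Sv x : x \in S -> #|S :\ x| = #|S|.-1 by move=> xS; rewrite (cardsD1 x S) xS.
have [v0|v0] := posnP #|nbrs F v|.
  have H := IH F (S :\ v) _ sF iF _ _ PF; rewrite Sv // in H.
  suff : (arcs F + 10 < 6 * #|S|.-1)%N by lia.
  have nv y : ~~ F v y.
    have /eqP := v0; rewrite cards_eq0 => /eqP/setP/(_ y).
    by rewrite !inE => ->.
  apply: H => [|x y xy|]; try lia.
  have /andP[xS yS] := FS _ _ xy; rewrite !inE xS yS !andbT.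
  apply/andP; split; first by apply: contraTneq xy => ->; apply: nv.
  by apply: contraTneq xy => ->; rewrite sF; apply: nv.
apply: (@dense_neighbourhood F v) => //; first by rewrite v0.
move=> u; rewrite inE => vu; rewrite ltnNge; apply/negP => few.
have /andP[_ uS] := FS _ _ vu.
(* With at most two common neighbours, the contraction costs at most 6 arcs, just what one vertex is
   worth in the bound. *)
have := arcs_contract sF iF vu => hc.
have H := IH (contract F v u) (S :\ u) _ (contract_sym _ _ sF)
  (@contract_irr _ _ _ _) _ _ (P_contract sF iF vu PF).
rewrite Sv // in H; suff : (arcs (contract F v u) + 10 < 6 * #|S|.-1)%N by lia.
apply: H => [|x y|]; try lia.
move=> /and4P[xy xu yu]; rewrite !inE xu yu /= => /or3P[/FS //| |].
  by move=> /andP[/eqP-> /FS/andP[_ ->]]; rewrite vS.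
by move=> /andP[/eqP-> /FS/andP[_ ->]]; rewrite vS.
Qed.

End Mader.

(** * Realizability passes to minors *)

Section RealizableMinors.
Variables (R : realFieldType) (V : finType).
Implicit Types (E F : rel V) (u v : V).

Lemma realizable_sub E F : subrel F E -> realizable R E -> realizable R F.
Proof.
move=> FE [p [r [r0 H]]]; exists p, r; split => // eta eta0.
have [c [h1 h2]] := H eta eta0; exists c; split => [u v /FE|]; first exact: h1.
by move=> u v x y /FE uv /FE xy; apply: h2.
Qed.

(** Points and [r] are kept. An edge that moves from [v] to [u] runs along two old chains that meet
    in [v]. *)
Lemma realizable_contract E u v : symmetric E -> irreflexive E -> E u v ->
  realizable R E -> realizable R (contract E u v).
Proof.
move=> sE iE uv [p [r [r0 H]]]; exists p, r; split => // eta eta0.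
have [c [h1 h2]] := H eta eta0.
pose c' x y := if E x y then c x y
  else if (x == u) && E v y then c u v ++ c v y else c x v ++ c v u.
have vu : E v u by rewrite sE.
exists c'; split.
  move=> x y /and4P[xy xv yv]; rewrite /c'.
  have [exy _|_ /=] := boolP (E x y); first exact: h1.
  have [/andP[/eqP-> vy] _|_ /=] := boolP (_ && _).
    have [a1 a2] := h1 _ _ uv; have [b1 b2] := h1 _ _ vy.
    by rewrite cat_path last_cat a1 a2 b1 b2.
  move=> /andP[/eqP-> vx]; have xv' : E x v by rewrite sE.
  have [a1 a2] := h1 _ _ xv'; have [b1 b2] := h1 _ _ vu.
  by rewrite cat_path last_cat a1 a2 b1 b2.
(* Each chain is covered by old edges which meet [v] only if it ends at [u]. *)
have cover x y a : contract E u v x y -> a \in p x :: c' x y ->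
    exists z : V * V, [/\ E z.1 z.2, a \in p z.1 :: c z.1 z.2,
      (z.1 == x) || (z.1 == y) || ((z.1 == v) && ((x == u) || (y == u)))
      & (z.2 == x) || (z.2 == y) || ((z.2 == v) && ((x == u) || (y == u)))].
  move=> /and4P[xy xv yv]; rewrite /c'.
  have [exy _ ha|_ /=] := boolP (E x y); first by exists (x, y); rewrite !eqxx orbT.
  have [/andP[/eqP-> vy] _|_ /=] := boolP (_ && _).
    rewrite inE mem_cat orbA => /orP[ha|ha].
      by exists (u, v); rewrite /= inE !eqxx !orbT.
    by exists (v, y); rewrite /= inE ha !eqxx !orbT.
  move=> /andP[/eqP-> vx]; have xv' : E x v by rewrite sE.
  rewrite inE mem_cat orbA => /orP[ha|ha].
    by exists (x, v); rewrite /= inE !eqxx !orbT.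
  by exists (v, u); rewrite /= inE ha !eqxx !orbT.
move=> x y z w xy zw xz xw yz yw a b ha hb.
have [[e1 e2] /= [He ea e1P e2P]] := cover _ _ _ xy ha.
have [[f1 f2] /= [Hf fb f1P f2P]] := cover _ _ _ zw hb.
move: xy zw => /and4P[_ xv yv _] /and4P[_ zv wv _].
(* Independent new edges cannot both end at [u], so at most one of the two covers uses [v]. *)
have sep e f : (e == x) || (e == y) || ((e == v) && ((x == u) || (y == u))) ->
   (f == z) || (f == w) || ((f == v) && ((z == u) || (w == u))) -> e != f.
  case/orP => [/orP[]/eqP->|/andP[/eqP-> xyu]];
  case/orP => [/orP[]/eqP->|/andP[/eqP-> zwu]] //; rewrite 1?eq_sym //.
  case/orP: xyu => /eqP e'; case/orP: zwu => /eqP f'; move: xz xw yz yw;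
  by rewrite e' f' eqxx.
by apply: (h2 _ _ _ _ He Hf) => //; apply: sep.
Qed.

Theorem realizable_arcs E (S : {set V}) : symmetric E -> irreflexive E ->
  (forall u v, E u v -> (u \in S) && (v \in S)) -> (2 < #|S|)%N ->
  realizable R E -> (arcs E + 10 < 6 * #|S|)%N.
Proof.
move=> sE iE ES S3; apply: (@mader V (realizable R (V := V))) => //.
- by move=> F u v; apply: realizable_sub => x y /andP[].
- by move=> F u v; apply: realizable_contract.
- by move=> F vs; apply: K5_not_realizable.
Qed.

End RealizableMinors.

(** * Drawings by arcs *)

Section ConnectedInvariant.
Local Open Scope classical_set_scope.

(** Local constancy makes the part of [A] inside [P] both relatively open and relatively closed. *)
Lemma connected_invariant (T : topologicalType) (A P : set T) (a : T) :
  connected A -> A a -> P a ->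
  (forall x, A x -> \forall y \near x, A y -> P x <-> P y) -> A `<=` P.
Proof.
move=> cA Aa Pa loc.
suff <- : A `&` P = A by move=> x [].
apply: cA; first by exists a.
- exists [set y | A y -> P y]^°; first exact: open_interior.
  apply/seteqP; split => x [Ax Px]; split => //.
    by have := loc x Ax; apply: filterS => y h /h <-.
  by have := interior_subset Px; apply.
- exists (~` [set y | A y -> ~ P y]^°); first exact/open_closedC/open_interior.
  apply/seteqP; split => x [Ax Px]; split => //.
    by move=> /interior_subset /(_ Ax); apply.
  apply: contrapT => nPx; apply: Px.
  by have := loc x Ax; apply: filterS => y h /h <-.
Qed.

End ConnectedInvariant.

(** * Chains in connected sets and their clearance from closed sets *)

Section Topology.
Variable R : realType.
Local Open Scope classical_set_scope.
Notation plane := (R * R)%type.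
Implicit Types (a b x y z : plane) (r eta : R) (A K X : set plane).

Lemma closeE r a b : close r a b = (`|a - b| <= r).
Proof. by rewrite prod_normE ge_max. Qed.

Lemma near_close x r : 0 < r -> \forall y \near x, close r x y.
Proof.
move=> r0; near=> y; rewrite closeE ltW //; near: y; exact: cvgr_dist_lt.
Unshelve. all: by end_near. Qed.

(** Being reachable by an [eta]-chain inside [A] does not change between points of [A] at distance
    at most [eta]. *)
Lemma connected_chain A a b eta : connected A -> A a -> A b -> 0 < eta ->
  exists s, [/\ path (close eta) a s, last a s = b & forall z, z \in a :: s -> A z].
Proof.
move=> cA Aa Ab eta0.
pose P y := exists s, [/\ path (close eta) a s, last a s = y &
  forall z, z \in a :: s -> A z].
have ext x y : A x -> A y -> close eta x y -> P x -> P y.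
  move=> Ax Ay xy [s [ps ls sA]]; exists (rcons s y).
  rewrite rcons_path ls ps xy last_rcons; split => // z.
  by rewrite inE mem_rcons inE orbCA => /orP[/eqP->|] //; apply: sA.
apply: (connected_invariant (P := P) cA Aa) => //.
  by exists [::]; split => // z; rewrite inE => /eqP->.
move=> x Ax; apply: filterS (near_close x eta0) => y xy Ay.
by split; apply: ext => //; rewrite close_sym.
Qed.

(** The differences form a compact set that avoids 0, and so avoids a ball about 0. *)
Lemma compact_apart K A : compact K -> compact A -> K `&` A = set0 ->
  exists2 r, 0 < r & forall x y, K x -> A y -> ~~ close r x y.
Proof.
move=> cK cA KA.
pose D := [set z.1 - z.2 | z in K `*` A].
have cD : compact D.
  apply: continuous_compact; last exact: compact_setX.
  apply: continuous_subspaceT => z.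
  by apply: cvgB; [exact: cvg_fst | exact: cvg_snd].
have D0 : ~ D 0.
  move=> [[x y] /= [Kx Ay] /eqP]; rewrite subr_eq0 => /eqP e.
  have : (K `&` A) x by split; rewrite // e.
  by rewrite KA.
have oD : open (~` D) by apply: closed_openC; apply: compact_closed.
have /nbhs_ballP [r /= r0 h] := open_nbhs_nbhs (conj oD D0).
exists (r / 2); first by rewrite divr_gt0.
move=> x y Kx Ay; rewrite closeE; apply/negP => le.
have /h : ball 0 r (x - y).
  rewrite -ball_normE /ball_ /= sub0r normrN (le_lt_trans le) //.
  by rewrite ltr_pdivrMr // ltr_pMr // ltr1n.
by apply; exists (x, y).
Qed.

(* A common positive clearance [r] from [X], for chains of any step. *)
Definition joined X r a b : Prop := forall eta, 0 < eta ->
  exists s, [/\ path (close eta) a s, last a s = b &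
    forall z d, z \in a :: s -> X d -> ~~ close r z d].

Lemma joined_sub X X' r r' a b : r' <= r -> X' `<=` X ->
  joined X r a b -> joined X' r' a b.
Proof.
move=> rr XX H eta eta0; have [s [h1 h2 h3]] := H eta eta0.
exists s; split => // z d zs /XX Xd.
by apply: contra (h3 z d zs Xd); apply: close_le.
Qed.

Lemma joined_trans X r a b c : joined X r a b -> joined X r b c -> joined X r a c.
Proof.
move=> H H' eta eta0; have [s [h1 h2 h3]] := H eta eta0.
have [t [k1 k2 k3]] := H' eta eta0; exists (s ++ t).
rewrite cat_path last_cat h1 h2 k1 k2; split => // z d.
by rewrite inE mem_cat orbA => /orP[hz|hz]; [apply: h3 | apply: k3; rewrite inE hz orbT].
Qed.

Lemma joined_sym X r a b : joined X r a b -> joined X r b a.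
Proof.
move=> H eta eta0; have [s [h1 h2 h3]] := H eta eta0.
exists (rev (belast a s)); split.
- rewrite -h2 rev_path; apply: sub_path h1 => x y /=.
  by rewrite close_sym.
- by case: s h1 h2 h3 => [|y s] _ //= _ _; rewrite rev_cons last_rcons.
- move=> z d; rewrite inE mem_rev -h2 => hz; apply: h3.
  by have := lastI a s; move: hz => + ->; rewrite mem_rcons inE.
Qed.

Lemma joined_segment X r x y :
  (forall t, 0 <= t <= 1 -> forall d, X d -> ~~ close r (x + t *: (y - x)) d) ->
  joined X r x y.
Proof.
move=> far eta eta0.
pose f (t : R) : plane := x + t *: (y - x).
have cf : {within `[0, 1], continuous f}.
  apply: continuous_subspaceT => t; apply: cvgD; first exact: cvg_cst.
  by apply: cvgZr_tmp; exact: cvg_id.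
have cA := connected_continuous_connected (@segment_connected R 0 1) cf.
have [||s [h1 h2 h3]] := @connected_chain _ x y eta cA _ _ eta0.
- by exists 0; rewrite /= ?in_itv /= ?lexx ?ler01 // /f scale0r addr0.
- by exists 1; rewrite /= ?in_itv /= ?lexx ?ler01 // /f scale1r addrC subrK.
exists s; split => // z d /h3[t]; rewrite /= in_itv /= => ht <-; exact: far.
Qed.

Lemma joined_close X r x y : (forall d, X d -> ~~ close (r + r) x d) ->
  close r x y -> joined X r x y.
Proof.
move=> far xy; apply: joined_segment => t /andP[t0 t1] d Xd.
apply: contra (far d Xd) => h; apply: close_trans h.
rewrite closeE opprD addNKr normrN normrZ ger0_norm //.
move: xy; rewrite closeE distrC => h; apply: le_trans h.
by rewrite ler_piMl.
Qed.

Lemma closed_apart X x : closed X -> ~ X x ->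
  exists2 r, 0 < r & forall d, X d -> ~~ close r x d.
Proof.
move=> cX nXx.
have /nbhs_ballP [r /= r0 h] := open_nbhs_nbhs (conj (closed_openC cX) nXx).
exists (r / 2); first by rewrite divr_gt0.
move=> d Xd; rewrite closeE; apply/negP => le; apply: (h d) Xd.
rewrite -ball_normE /ball_ /= (le_lt_trans le) //.
by rewrite ltr_pdivrMr // ltr_pMr // ltr1n.
Qed.

(** Being joined to [z] with some positive clearance is locally constant off the closed set [X]; the
    clearance may shrink from point to point. *)
Lemma component_joined X z w : closed X ->
  connected_component (~` X) z w -> exists2 r, 0 < r & joined X r z w.
Proof.
move=> cX zw.
have nXz : ~ X z by case: zw => B [Bz BX _] _; exact: BX.
pose P w := exists2 r, 0 < r & joined X r z w.
have := @connected_invariant _ _ P z (@component_connected _ (~` X) z).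
apply => //.
- by case: zw => B [Bz BX cB] Bw; exists B.
- have [r r0 h] := closed_apart cX nXz; exists r => // eta eta0.
  by exists [::]; split => // y d; rewrite inE => /eqP->; apply: h.
move=> x /connected_component_sub nXx.
have [r r0 h] := closed_apart cX nXx.
have r20 : 0 < r / 2 by rewrite divr_gt0.
have xyJ y : close (r / 2) x y -> joined X (r / 2) x y.
  by apply: joined_close => d /h; rewrite -splitr.
apply: filterS (near_close x r20) => y xy _; split => -[r' r'0 H].
- exists (Num.min r' (r / 2)); first by rewrite lt_min r'0.
  apply: joined_trans (joined_sub _ _ (xyJ y xy)) => //; last by rewrite ge_min lexx orbT.
  by apply: joined_sub H => //; rewrite ge_min lexx.
- exists (Num.min r' (r / 2)); first by rewrite lt_min r'0.
  apply: joined_trans (joined_sub _ _ (joined_sym (xyJ y xy))) => //.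
    by apply: joined_sub H => //; rewrite ge_min lexx.
  by rewrite ge_min lexx orbT.
Qed.

(** Used to choose one distance for all pairs of edges, or for all vertices. *)
Lemma finite_uniform (I : finType) (P : I -> R -> Prop) :
  (forall i r r', r' <= r -> P i r -> P i r') ->
  (forall i, exists2 r, 0 < r & P i r) -> exists2 r, 0 < r & forall i, P i r.
Proof.
move=> mono H; suff [r r0 h] : exists2 r, 0 < r & forall i, i \in enum I -> P i r.
  by exists r => // i; apply: h; rewrite mem_enum.
elim: (enum I) => [|i s [r r0 h]]; first by exists 1.
have [r' r'0 h'] := H i; exists (Num.min r r'); first by rewrite lt_min r0.
move=> j; rewrite inE => /predU1P[->|/h].
  by apply: mono h'; rewrite ge_min lexx orbT.
by apply: mono; rewrite ge_min lexx.
Qed.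

End Topology.

(** * From plane drawings to realizations *)

Section Drawings.
Variables (R : realType) (G : sgraph) (p : G -> R * R) (A : G -> G -> set (R * R)).
Local Open Scope classical_set_scope.
Hypothesis drawing : plane_drawing p A.
Implicit Types (u v w x y : G).

Lemma drawn_arc u v : adj u v ->
  [/\ compact (A u v), connected (A u v), A u v (p u) & A u v (p v)].
Proof.
case: drawing => _ arcA _ _ _ /arcA[f [cf _ f0 f1 <-]]; split.
- by apply: continuous_compact => //; apply: segment_compact.
- by apply: connected_continuous_connected => //; apply: segment_connected.
- by exists 0; rewrite //= in_itv /= lexx ler01.
- by exists 1; rewrite //= in_itv /= lexx ler01.
Qed.

Lemma drawn_arcs_disjoint u v x y : adj u v -> adj x y ->
  u != x -> u != y -> v != x -> v != y -> A u v `&` A x y = set0.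
Proof.
move=> uv xy ux uy vx vy; case: drawing => _ _ _ Avert Across.
apply/seteqP; split => // z Az.
have [w _ wz] : range p z.
  apply: (Across u v x y) => //; apply/eqP => /setP/(_ u).
  by rewrite !finset.inE eqxx (negbTE ux) (negbTE uy).
case: Az; rewrite -wz => /(Avert _ _ _ uv) h1 /(Avert _ _ _ xy) h2.
by case: h1 ux uy vx vy => <-; case: h2 => <-; rewrite eqxx.
Qed.

Lemma drawn_arcs_apart : exists2 r : R, 0 < r &
  forall u v x y, adj u v -> adj x y -> u != x -> u != y -> v != x -> v != y ->
  forall a b, A u v a -> A x y b -> ~~ close r a b.
Proof.
have [||r r0 h] := @finite_uniform R (G * G * (G * G))%type
  (fun e r => adj e.1.1 e.1.2 -> adj e.2.1 e.2.2 ->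
    e.1.1 != e.2.1 -> e.1.1 != e.2.2 -> e.1.2 != e.2.1 -> e.1.2 != e.2.2 ->
    forall a b, A e.1.1 e.1.2 a -> A e.2.1 e.2.2 b -> ~~ close r a b).
- move=> e r r' rr h e1 e2 n1 n2 n3 n4 a b Aa Ab.
  by apply: contra (h e1 e2 n1 n2 n3 n4 a b Aa Ab); apply: close_le.
- move=> [[u v] [x y]] /=.
  have [/and5P[/andP[uv xy] ux uy vx vy]|n] := boolP
      [&& adj u v && adj x y, u != x, u != y, v != x & v != y]; last first.
    by exists 1 => // uv xy ux uy vx vy; move: n; rewrite uv xy ux uy vx vy.
  have [cu _ _ _] := drawn_arc uv; have [cx _ _ _] := drawn_arc xy.
  have [r r0 h] := compact_apart cu cx (drawn_arcs_disjoint uv xy ux uy vx vy).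
  by exists r => // _ _ _ _ _ _; apply: h.
by exists r => // u v x y; apply: (h (u, v, (x, y))).
Qed.

Lemma drawn_arcs_chains (eta : R) : 0 < eta -> exists c : G * G -> seq (R * R),
  forall e, adj e.1 e.2 -> [/\ path (close eta) (p e.1) (c e),
    last (p e.1) (c e) = p e.2 & forall z, z \in p e.1 :: c e -> A e.1 e.2 z].
Proof.
move=> eta0.
have [e|c h] := @choice (G * G)%type (seq (R * R)) (fun e s => adj e.1 e.2 ->
  [/\ path (close eta) (p e.1) s,
    last (p e.1) s = p e.2 & forall z, z \in p e.1 :: s -> A e.1 e.2 z]).
  have [uv|_] := boolP (adj e.1 e.2); last by exists [::].
  have [_ cA Au Av] := drawn_arc uv.
  by have [s h] := connected_chain cA Au Av eta0; exists s.
by exists c.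
Qed.

Lemma drawing_realizable : realizable R (@adj G).
Proof.
have [r r0 far] := drawn_arcs_apart.
exists p, r; split => // eta eta0; have [c hc] := drawn_arcs_chains eta0.
exists (fun u v => c (u, v)); split => [u v uv|u v x y uv xy ux uy vx vy a b ha hb].
  by have [h1 h2 _] := hc (u, v) uv.
have [_ _ h1] := hc (u, v) uv; have [_ _ h2] := hc (x, y) xy.
by apply: (far u v x y) => //; [apply: h1 | apply: h2].
Qed.

Lemma drawing_points_compact : compact (drawing_points p A).
Proof.
apply: compactU; first by apply: finite_compact; exact: finite_image.
pose B (e : G * G) := if adj e.1 e.2 then A e.1 e.2 else set0.
rewrite [X in compact X](_ : _ = \bigcup_(e in [set` enum {: G * G}]) B e).
  rewrite bigcup_seq; apply: bigsetU_compact => e _; rewrite /B.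
  by case: ifP => [uv|_]; [have [] := drawn_arc uv | exact: compact0].
apply/seteqP; split => z.
  by move=> [u [v [uv Az]]]; exists (u, v); rewrite /= ?mem_enum // /B /= uv.
by move=> [[u v] _]; rewrite /B /=; case: ifP => // uv Az; exists u, v.
Qed.

Lemma drawing_points_closed : closed (drawing_points p A).
Proof. by apply: compact_closed drawing_points_compact; exact: norm_hausdorff. Qed.

Lemma drawing_points_bounded : exists2 M : R, 0 <= M &
  forall d, drawing_points p A d -> (`|d.1| <= M) && (`|d.2| <= M).
Proof.
have [M0 [_ hM]] := compact_bounded drawing_points_compact.
exists (Num.max 0 (M0 + 1)); first by rewrite le_max lexx.
move=> d /(hM (M0 + 1) (ltr_pwDr ltr01 (lexx _))) /=; rewrite prod_normE ge_max => /andP[h1 h2].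
by rewrite !le_max h1 h2 !orbT.
Qed.

(* Outside the square [-M, M]^2 everything can be joined to the corner
   (M + 3, M + 3) by a vertical and a horizontal segment. *)
Lemma far_joined (X : set (R * R)) (M : R) (w : R * R) :
  (forall d, X d -> (`|d.1| <= M) && (`|d.2| <= M)) ->
  (M + 2 < `|w.1|) || (M + 2 < `|w.2|) -> joined X 1 w (M + 3, M + 3).
Proof.
move=> XM; have far z d : X d -> (M + 2 < `|z.1|) || (M + 2 < `|z.2|) ->
    ~~ close 1 z d.
  move=> /XM /andP[d1 d2] h; apply/negP => /andP[c1 c2].
  have l1 := ler_normD (z.1 - d.1) d.1; have l2 := ler_normD (z.2 - d.2) d.2.
  by move: l1 l2 h; rewrite !subrK => l1 l2 /orP[h|h]; lra.
have M3 : M + 2 < `|M + 3|.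
  by apply: lt_le_trans (ler_norm _); rewrite ltrD2l ltr_nat.
case: w => x y /= /orP[hx|hy].
- apply: (@joined_trans _ _ _ _ (x, M + 3)); apply: joined_segment => t _ d Xd;
  apply: far => //=.
    by rewrite subrr scaler0 addr0 hx.
  by rewrite subrr scaler0 addr0 M3 orbT.
- apply: (@joined_trans _ _ _ _ (M + 3, y)); apply: joined_segment => t _ d Xd;
  apply: far => //=.
    by rewrite subrr scaler0 addr0 hy orbT.
  by rewrite subrr scaler0 addr0 M3.
Qed.

(** The arcs that do not end at [v] keep a distance from [p v]. The route goes to a nearby point [z]
    of the outer face, then inside its unbounded component to a point [w] outside the square, then
    to the corner. *)
Lemma boundary_vertex_joined (M : R) v :
  (forall d, drawing_points p A d -> (`|d.1| <= M) && (`|d.2| <= M)) ->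
  boundary (outer_face p A) (p v) ->
  exists2 r : R, 0 < r & joined
    [set z | exists x y, [/\ adj x y, v != x, v != y & A x y z]] r
    (p v) (M + 3, M + 3).
Proof.
move=> DM [bd _]; set X := [set z | _].
have XD : X `<=` drawing_points p A.
  by move=> z [x [y [xy _ _ Az]]]; right; exists x, y.
have [_ _ _ Avert _] := drawing.
have [r r0 hr] : exists2 r : R, 0 < r & forall d, X d -> ~~ close r (p v) d.
  have [||r r0 h] := @finite_uniform R (G * G)%type (fun e r =>
      adj e.1 e.2 -> v != e.1 -> v != e.2 ->
      forall d, A e.1 e.2 d -> ~~ close r (p v) d).
  - move=> e r r' rr h e1 e2 e3 d Ad; apply: contra (h e1 e2 e3 d Ad).
    exact: close_le.
  - move=> [x y] /=.
    have [/and3P[xy vx vy]|n] := boolP [&& adj x y, v != x & v != y]; last first.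
      by exists 1 => // xy vx vy; move: n; rewrite xy vx vy.
    have [cA _ _ _] := drawn_arc xy.
    have [||r r0 h] := @closed_apart R (A x y) (p v).
    + by apply: compact_closed cA; exact: norm_hausdorff.
    + by move=> /(Avert _ _ _ xy) [e|e]; move: vx vy; rewrite e eqxx.
    by exists r => // _ _ _.
  by exists r => // d [x [y [xy vx vy Ad]]]; apply: (h (x, y)).
have r20 : 0 < r / 2 by rewrite divr_gt0.
have [z [oz cz]] := bd _ (near_close (p v) r20).
have J1 : joined X (r / 2) (p v) z.
  by apply: joined_close cz => d Xd; rewrite -splitr; apply: hr.
have [w zw hw] : exists2 w, connected_component (~` drawing_points p A) z w &
    (M + 2 < `|w.1|) || (M + 2 < `|w.2|).
  apply: contrapT => no; apply: oz; exists (M + 2); split; first exact: num_real.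
  move=> N MN w zw; apply: le_trans (ltW MN); rewrite /=.
  rewrite prod_normE ge_max; apply/andP; split; rewrite leNgt; apply/negP => lt;
  by apply: no; exists w; rewrite ?lt ?orbT.
have [s s0 J2] := component_joined drawing_points_closed zw.
have J3 := far_joined DM hw.
pose m := Num.min (r / 2) (Num.min s 1).
exists m; first by rewrite !lt_min r20 s0 ltr01.
apply: (joined_trans (b := z)); first by apply: joined_sub J1; rewrite // ge_min lexx.
apply: (joined_trans (b := w)).
  by apply: joined_sub J2; rewrite // !ge_min lexx orbT.
by apply: joined_sub J3; rewrite // !ge_min lexx !orbT.
Qed.

End Drawings.

(** * The cone over an outerplanar graph *)

Section Cone.
Variables (R : realType) (G : sgraph).
Local Open Scope classical_set_scope.
Implicit Types (u v w x y : G).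

Definition cone_adj : rel (option G) := fun a b =>
  match a, b with
  | Some u, Some v => adj u v
  | None, None => false
  | _, _ => true
  end.

Lemma cone_adj_sym : symmetric cone_adj.
Proof. by move=> [u|] [v|] //=; apply: adj_sym. Qed.

Lemma cone_adj_irrefl : irreflexive cone_adj.
Proof. by move=> [u|] //=; apply: adj_irrefl. Qed.

(* The apex is put in the outer face, far away from the drawing. *)
Lemma cone_realizable : outerplanar R G -> realizable R cone_adj.
Proof.
move=> [p [A [drawing outer]]].
have [M M0 DM] := drawing_points_bounded drawing.
have [r1 r10 far] := drawn_arcs_apart drawing.
pose X v := [set z | exists x y, [/\ adj x y, v != x, v != y & A x y z]].
have [||r2 r20 J] := @finite_uniform R G (fun v r =>
  joined (X v) r (p v) (M + 3, M + 3)).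
- by move=> v r r' rr; apply: joined_sub.
- by move=> v; apply: (boundary_vertex_joined drawing DM (outer v)).
pose q (a : option G) := if a is Some v then p v else (M + 3, M + 3).
exists q, (Num.min r1 r2); split; first by rewrite lt_min r10.
have r1l : Num.min r1 r2 <= r1 by rewrite ge_min lexx.
have r2l : Num.min r1 r2 <= r2 by rewrite ge_min lexx orbT.
move=> eta eta0.
have [c hc] := drawn_arcs_chains drawing eta0.
have [s hs] := choice (fun v => J v eta eta0).
have [t ht] := choice (fun v => joined_sym (J v) eta0).
pose C (a b : option G) := match a, b with
  | Some u, Some v => c (u, v) | Some u, None => s u
  | None, Some v => t v | None, None => [::] end.
(* The edge between [v] and the apex, in either direction. *)
pose star v a b := (a = Some v /\ b = None) \/ (a = None /\ b = Some v).
have starP v a b z x y d : star v a b -> z \in q a :: C a b ->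
    adj x y -> v != x -> v != y -> A x y d -> ~~ close r2 z d.
  move=> ab hz xy vx vy Ad; have Xd : X v d by exists x, y.
  case: ab hz => -[-> ->] hz.
    by have [_ _] := hs v; apply.
  by have [_ _] := ht v; apply.
exists C; split.
  move=> [u|] [v|] //=.
  - by move=> uv; have [? ? _] := hc (u, v) uv.
  - by move=> _; have [? ? _] := hs u.
  - by move=> _; have [? ? _] := ht v.
have star_far v a b x y z d : star v a b -> adj x y ->
    a != Some x -> a != Some y -> b != Some x -> b != Some y ->
    z \in q a :: C a b -> d \in q (Some x) :: C (Some x) (Some y) ->
    ~~ close (Num.min r1 r2) z d.
  move=> ab xy ax ay bx by_ hz hd.
  have [vx vy] : v != x /\ v != y.
    by case: ab ax ay bx by_ => -[-> ->].
  have [_ _ /(_ d hd) Ad] := hc (x, y) xy.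
  by apply: contra (starP v a b z x y d ab hz xy vx vy Ad); apply: close_le.
(* Two edges at the apex are never independent, so at most one of the pair is a [star] edge. *)
move=> a b e f ab ef ae af be bf z d hz hd.
case: a b e f ab ef ae af be bf hz hd => [u|] [v|] [x|] [y|] //.
- move=> uv xy ux uy vx vy hz hd.
  have [_ _ /(_ z hz) Az] := hc (u, v) uv; have [_ _ /(_ d hd) Ad] := hc (x, y) xy.
  by apply: contra (far u v x y uv xy ux uy vx vy z d Az Ad); apply: close_le.
- move=> uv _ ux uy vx vy hz hd; rewrite close_sym.
  by apply: (star_far x (Some x) None u v d z) => //; [left | rewrite eq_sym..].
- move=> uv _ ux uy vx vy hz hd; rewrite close_sym.
  by apply: (star_far y None (Some y) u v d z) => //; [right | rewrite eq_sym..].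
- move=> _ xy ux uy vx vy hz hd.
  by apply: (star_far u (Some u) None x y z d) => //; left.
- move=> _ xy ux uy vx vy hz hd.
  by apply: (star_far v None (Some v) x y z d) => //; right.
Qed.

Lemma arcs_cone : arcs cone_adj = (arcs (@adj G) + 2 * #|G|)%N.
Proof.
rewrite !arcs_sum (bigD1 None) //=.
have -> : #|nbrs cone_adj None| = #|G|.
  rewrite -(card_imset (mem G) (@Some_inj _)); apply: eq_card => -[v|].
    by rewrite !finset.inE /= imset_f.
  by rewrite !finset.inE /=; apply/esym/negbTE/imsetP => -[].
rewrite (reindex_omap Some id) /=; last by case.
rewrite (eq_bigr (fun v => #|nbrs (@adj G) v| + 1)%N); last first.
  move=> v _; rewrite -(card_imset (mem (nbrs _ v)) (@Some_inj _)).
  rewrite (cardsD1 None (nbrs cone_adj _)) {1}/nbrs finset.inE /= addnC.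
  congr addn; apply: eq_card => -[w|].
    by rewrite !finset.inE /= mem_imset ?finset.inE //; exact: Some_inj.
  by rewrite !finset.inE /=; apply/esym/negbTE/imsetP => -[].
rewrite (eq_bigl predT) => [|v]; last by rewrite /= eqxx.
by rewrite big_split /= sum_nat_const muln1 cardT -cardE; lia.
Qed.

End Cone.

(** * Edge bounds for planar and outerplanar graphs *)

Section EdgeBounds.
Variables (R : realType) (G : sgraph).
Implicit Types (u v w x y : G).

Lemma eq_set2 (T : finType) (a b c d : T) :
  [set a; b]%SET = [set c; d]%SET -> (a = c /\ b = d) \/ (a = d /\ b = c).
Proof.
move=> e; have : a \in [set c; d]%SET by rewrite -e finset.set21.
have : b \in [set c; d]%SET by rewrite -e finset.set22.
have : c \in [set a; b]%SET by rewrite e finset.set21.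
have : d \in [set a; b]%SET by rewrite e finset.set22.
rewrite !finset.inE => /orP[]/eqP ? /orP[]/eqP ? /orP[]/eqP ? /orP[]/eqP ?;
subst; by [left | right].
Qed.

Lemma arcs_edges : arcs (@adj G) = (2 * #|edges G|)%N.
Proof.
rewrite /arcs -sum1_card.
rewrite (partition_big (fun z : G * G => [set z.1; z.2]%SET) (mem (edges G))) /=; last first.
  by move=> z hz; apply: imset_f.
rewrite mulnC -sum_nat_const; apply: eq_bigr => e /imsetP[[u v]] /=.
rewrite finset.inE /= => uv ->.
rewrite sum1_card (_ : 2%N = #|[set (u, v); (v, u)]%SET|); last first.
  rewrite cards2 xpair_eqE; have -> : (u == v) = false; last by [].
  by apply/eqP => e1; move: uv; rewrite e1 adj_irrefl.
apply: eq_card => -[x y]; rewrite !finset.inE /=.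
apply/andP/orP => [[xy /eqP /eq_set2 /= [] [-> ->]]|[] /eqP [-> ->]].
- by left.
- by right.
- by rewrite finset.inE eqxx.
- by rewrite finset.inE /= adj_sym finset.setUC eqxx.
Qed.

Lemma degree_sum : (\sum_(v : G) degree v = 2 * #|edges G|)%N.
Proof. by rewrite -arcs_edges arcs_sum. Qed.

Lemma planar_edges : planar R G -> (2 < #|G|)%N -> (#|edges G| + 6 <= 3 * #|G|)%N.
Proof.
move=> [p [A drawing]] n3.
have := realizable_arcs (S := [set: G]%SET) (@adj_sym G) (@adj_irrefl G) _ _
  (drawing_realizable drawing).
rewrite cardsT arcs_edges => /(_ _ n3) h.
have {h} /h : forall u v, adj u v -> (u \in [set: G]%SET) && (v \in [set: G]%SET).
  by move=> u v; rewrite !finset.in_setT.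
by lia.
Qed.

(** The cone has [n + 1] vertices and [e + n] edges, whence [e + n <= 3 (n + 1) - 6]. *)
Lemma outerplanar_edges : outerplanar R G -> (1 < #|G|)%N ->
  (#|edges G| + 3 <= 2 * #|G|)%N.
Proof.
move=> oG n2.
have := realizable_arcs (S := [set: option G]%SET) (@cone_adj_sym G)
  (@cone_adj_irrefl G) _ _ (cone_realizable oG).
rewrite cardsT card_option arcs_cone arcs_edges => /(_ _ n2) h.
have {h} /h : forall u v : option G, cone_adj u v ->
    (u \in [set: option G]%SET) && (v \in [set: option G]%SET).
  by move=> u v; rewrite !finset.in_setT.
by lia.
Qed.

(** The edge bound for [G] without [S]. Deleting [S] removes the arcs that start in it and the arcs
    that end in it; each kind numbers the degree sum over [S], and arcs inside [S] belong to
    both. *)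
Lemma planar_edges_off (S : {set G}) : planar R G -> (2 < #|~: S|%SET)%N ->
  (2 * #|edges G| + 10 + #|[set z : G * G | [&& z.1 \in S, z.2 \in S & adj z.1 z.2]]|
   < 6 * #|~: S|%SET + 2 * \sum_(v in S) degree v)%N.
Proof.
move=> [p [A drawing]] S3.
pose F : rel G := fun x y => [&& adj x y, x \notin S & y \notin S].
have h1 : symmetric F by move=> x y; rewrite /F adj_sym (andbC (x \notin S)).
have h2 : irreflexive F by move=> x; rewrite /F adj_irrefl.
have h3 : forall u v, F u v -> (u \in ~: S) && (v \in ~: S).
  by move=> u v /and3P[_]; rewrite !finset.inE => -> ->.
have h4 : realizable R F.
  by apply: realizable_sub (drawing_realizable drawing) => x y /andP[].
have := realizable_arcs h1 h2 h3 S3 h4; rewrite -arcs_edges /arcs.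
set M := [set z : G * G | adj z.1 z.2]%SET.
pose P1 := [set z : G * G | z.1 \in S]%SET.
pose P2 := [set z : G * G | z.2 \in S]%SET.
have -> : [set z : G * G | F z.1 z.2]%SET = (M :\: P1 :\: P2)%SET.
  apply/setP => z; rewrite !finset.inE /F.
  by case: (adj _ _); case: (_ \in S); case: (_ \in S).
have -> : [set z : G * G | [&& z.1 \in S, z.2 \in S & adj z.1 z.2]]%SET =
    (M :&: P2 :&: P1)%SET.
  apply/setP => z; rewrite !finset.inE.
  by case: (adj _ _); case: (_ \in S); case: (_ \in S).
have s1 : (\sum_(v in S) degree v = #|(M :&: P1)%SET|)%N.
  rewrite -sum1_card; under eq_bigr do rewrite /degree -sum1_card.
  rewrite pair_big_dep /=; apply: eq_bigl => z.
  by rewrite !finset.inE andbC.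
have s2 : (\sum_(v in S) degree v = #|(M :&: P2)%SET|)%N.
  have swap_inj : injective (fun z : G * G => (z.2, z.1)).
    by move=> [a b] [c d] [-> ->].
  rewrite s1 -(card_imset (M :&: P1)%SET swap_inj).
  apply: eq_card => -[x y]; rewrite !finset.inE /=.
  apply/imsetP/idP => [[[u v]]|/andP[xy yS]].
    by rewrite !finset.inE /= => /andP[uv uS] [-> ->]; rewrite adj_sym uv.
  by exists (y, x); rewrite // !finset.inE /= adj_sym xy.
rewrite -(cardsID P1 M) -(cardsID P2 (M :\: P1)%SET).
have e1 := cardsID P1 (M :&: P2)%SET.
have e2 : ((M :\: P1) :&: P2)%SET = ((M :&: P2) :\: P1)%SET.
  apply/setP => z; rewrite !finset.inE.
  by case: (adj _ _); case: (_ \in S); case: (_ \in S).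
rewrite e2; lia.
Qed.

End EdgeBounds.

(** * Degree classes *)

Section Colouring.
Variables (V : finType) (E : rel V) (W : {set V}).
Hypotheses (E_sym : symmetric E) (E_irr : irreflexive E).
Implicit Types (u v x y : V) (k : nat).

(* A colouring with the fewest monochromatic edges: recolouring a vertex with
   a colour that is rarest among its neighbours does not help. *)
Lemma lovasz_colouring (T : finType) (D : nat) :
  (forall v, #|nbrs E v| <= D)%N -> (D < 3 * #|T|)%N ->
  exists f : {ffun V -> T}, forall v, (#|[set w in nbrs E v | f w == f v]| <= 2)%N.
Proof.
move=> degD DT.
have /card_gt0P[t0 _] : (0 < #|T|)%N by lia.
pose mono (f : {ffun V -> T}) := #|[set z : V * V | E z.1 z.2 && (f z.1 == f z.2)]|.
pose at_ (f : {ffun V -> T}) v c := #|[set w in nbrs E v | f w == c]|.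
pose off (f : {ffun V -> T}) v :=
  #|[set z : V * V | [&& z.1 != v, z.2 != v, E z.1 z.2 & f z.1 == f z.2]]|.
(* Only the first summand changes when [v] is recoloured. *)
have split_mono f v : mono f = (2 * at_ f v (f v) + off f v)%N.
  pose P1 := [set z : V * V | z.1 == v]%SET.
  pose P2 := [set z : V * V | z.2 == v]%SET.
  rewrite /mono -(cardsID P1) -(cardsID P2 (_ :\: P1)) addnA; congr addn.
    have inj1 : injective (fun w : V => (v, w)) by move=> x y [->].
    have inj2 : injective (fun w : V => (w, v)) by move=> x y [->].
    rewrite mul2n -addnn /at_ -{1}(card_imset [set w in nbrs E v | f w == f v]%SET inj1).
    rewrite -(card_imset [set w in nbrs E v | f w == f v]%SET inj2).
    congr addn; apply: eq_card => -[x y]; rewrite !finset.inE /=.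
      apply/idP/imsetP => [/andP[/andP[xy fxy] /eqP xv]|[w hw [-> ->]]].
        by exists y; rewrite ?xv // !finset.inE -xv xy eq_sym.
      by move: hw; rewrite !finset.inE eqxx eq_sym => /andP[-> ->].
    apply/idP/imsetP => [/andP[/andP[xv /andP[xy fxy]] /eqP yv]|[w hw [-> ->]]].
      by exists x; rewrite ?yv // !finset.inE -yv E_sym xy fxy.
    move: hw; rewrite !finset.inE eqxx E_sym => /andP[vw ->]; rewrite vw !andbT.
    by apply: contraTneq vw => ->; rewrite E_irr.
  apply: eq_card => -[x y]; rewrite !finset.inE /=.
  by case: (x == v); case: (y == v); rewrite ?andbF ?andbT.
have [f _ fmin] := arg_minnP (fun f => mono f) (isT : xpredT [ffun=> t0]).
exists f => v; rewrite leqNgt; apply/negP => many.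
have [c hc] : exists c, (at_ f v c <= 2)%N.
  apply/existsP; apply: contraTT (DT); rewrite negb_exists => /forallP h.
  rewrite -leqNgt; apply: leq_trans (degD v).
  rewrite -sum1_card (partition_big f predT) //= mulnC -sum_nat_const.
  apply: leq_sum => c _; rewrite sum1_card.
  have := h c; rewrite -ltnNge => /leq_trans; apply.
  by rewrite /at_ cardsE; apply: eq_leq; apply: eq_card => w.
pose g := [ffun w => if w == v then c else f w].
have := fmin g isT; rewrite (split_mono f v) (split_mono g v).
have -> : off g v = off f v.
  apply: eq_card => -[x y]; rewrite !finset.inE /=.
  case: eqVneq => //= xv; case: eqVneq => //= yv.
  by rewrite !ffunE (negbTE xv) (negbTE yv).
have -> : at_ g v (g v) = at_ f v c.
  rewrite ffunE eqxx; apply: eq_card => w; rewrite !finset.inE ffunE.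
  by have [->|] := eqVneq w v; rewrite ?E_irr.
have : (2 < at_ f v (f v))%N by [].
by lia.
Qed.

Lemma colour_class (a D k : nat) :
  (forall v, #|nbrs E v| <= D)%N -> (D < 3 * k)%N ->
  (forall S : {set V}, S \subset W ->
    (forall v, v \in S -> #|[set w in S | E v w]| <= 2)%N -> #|S| <= a)%N ->
  (#|W| <= k * a)%N.
Proof.
move=> degD Dk small.
have [|f hf] := @lovasz_colouring 'I_k D degD; first by rewrite card_ord.
rewrite -sum1_card (partition_big f predT) //=.
rewrite -[k in leqRHS]card_ord -sum_nat_const; apply: leq_sum => c _.
rewrite sum1_card; set S := [set w in W | f w == c]%SET.
rewrite (_ : #|_| = #|S|); last by apply: eq_card => w; rewrite !finset.inE.
apply: small => [|v].
  by apply/fintype.subsetP => w; rewrite !finset.inE => /andP[].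
rewrite !finset.inE => /andP[vW /eqP fv]; apply: leq_trans (hf v).
apply: subset_leq_card; apply/fintype.subsetP => w; rewrite !finset.inE fv.
by move=> /andP[/andP[_ ->] ->].
Qed.

End Colouring.

(** * Greedy domination in graphs of maximum degree 3 *)

Section Cubic.
Variables (V : finType) (E : rel V) (W : {set V}).
Hypotheses (E_sym : symmetric E) (E_irr : irreflexive E).
Hypothesis E_sub : forall x y, E x y -> (x \in W) && (y \in W).
Hypothesis deg3 : forall x, (#|nbrs E x| <= 3)%N.
Implicit Types (u v x y d : V) (k : nat) (U D : {set V}).

Let N x : {set V} := x |: nbrs E x.
(** The vertices to be dominated: deleting a set that dominates them leaves maximum degree at most
    2. *)
Let T : {set V} := [set x in W | #|nbrs E x| == 3%N]%SET.

Let mem_N x y : (y \in N x) = (y == x) || E x y.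
Proof. by rewrite !finset.inE. Qed.

Let N_sym x y : (y \in N x) = (x \in N y).
Proof. by rewrite !mem_N eq_sym E_sym. Qed.

Let card_N x : (#|N x| <= 4)%N.
Proof. by rewrite cardsU1 !finset.inE E_irr; have := deg3 x; lia. Qed.

Let card_NT x : x \in T -> #|N x| = 4%N.
Proof. by rewrite cardsU1 !finset.inE E_irr => /andP[_ /eqP->]. Qed.

Let N_W x : x \in W -> N x \subset W.
Proof.
move=> xW; apply/fintype.subsetP => y; rewrite mem_N => /predU1P[->|/E_sub/andP[]] //.
Qed.

Let incidences U : U \subset T -> (\sum_(x in W) #|N x :&: U| = 4 * #|U|)%N.
Proof.
move=> UT; transitivity (\sum_(x in W) \sum_(u in U) (u \in N x))%N.
  apply: eq_bigr => x _; rewrite -sum1_card big_mkcond [RHS]big_mkcond /=.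
  by apply: eq_bigr => u _; rewrite finset.inE andbC; case: (u \in U); case: (u \in N x).
rewrite exchange_big /= mulnC -sum_nat_const; apply: eq_bigr => u /(fintype.subsetP UT) uT.
rewrite -(card_NT uT) -sum1_card big_mkcond [RHS]big_mkcond /=; apply: eq_bigr => x _.
rewrite N_sym; have [ux|_] := boolP (x \in N u); last by case: ifP.
have uW : u \in W by move: uT; rewrite finset.inE => /andP[].
by rewrite (fintype.subsetP (N_W uW)).
Qed.

(* Greedily choose vertices whose closed neighbourhoods contain [k] vertices
   that are not yet dominated. *)
Let phase k D U : D \subset W -> {in D, forall d, N d :&: U = finset.set0} ->
  {in W, forall x, #|N x :&: U| <= k.+1}%N ->
  exists D' U', [/\ D \subset D', D' \subset W,
    {in D', forall d, N d :&: U' = finset.set0} &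
    [/\ {in W, forall x, #|N x :&: U'| <= k}%N,
      U' \subset U,
      (#|U| + k.+1 * #|D| = #|U'| + k.+1 * #|D'|)%N,
      {in U, forall u, u \notin U' -> exists2 d, d \in D' & u \in N d} &
      {in D', forall d, d \notin D -> (k < #|N d :&: U|)%N}]].
Proof.
have [n] := ubnP #|U|; elim: n D U => // n IH D U hn DW DU Uk.
have [/exists_inP[x xW hx]|none] := boolP [exists x in W, (k < #|N x :&: U|)%N]; last first.
  exists D, U; split => //; split => // [x xW|u -> //|d ->] //.
  by rewrite leqNgt; apply: contra none => h; apply/exists_inP; exists x.
have xD : x \notin D.
  by apply: contraTN hx => /DU ->; rewrite cards0.
have cU : #|U :\: N x| = (#|U| - k.+1)%N.
  have := cardsID (N x) U; rewrite finset.setIC; have := Uk x xW; lia.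
have kU : (k.+1 <= #|U|)%N by apply: leq_trans hx (subset_leq_card (finset.subsetIr _ _)).
have [||||D' [U' [s1 s2 s3 [s4 s5 s6 s7 s8]]]] := IH (x |: D) (U :\: N x).
- by rewrite cU; lia.
- by rewrite finset.subUset finset.sub1set xW.
- move=> d /setU1P[->|dD]; apply/setP => y; rewrite !finset.inE.
    by case: (_ || _).
  by have /setP/(_ y) := DU d dD; rewrite !finset.inE => h; rewrite andbCA h andbF.
- move=> y yW; apply: leq_trans (Uk y yW).
  by apply: subset_leq_card; apply: finset.setIS; apply: finset.subsetDl.
exists D', U'; split => //.
  by apply: fintype.subset_trans s1; apply: finset.subsetUr.
split => //.
- by apply: fintype.subset_trans s5 (finset.subsetDl _ _).
- by move: s6; rewrite cU cardsU1 xD; lia.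
- move=> u uU uU'; have [ux|ux] := boolP (u \in N x).
    by exists x => //; apply: (fintype.subsetP s1); rewrite finset.setU11.
  by apply: s7; rewrite // finset.inE ux.
- move=> d dD' dD; have [->//|dx] := eqVneq d x.
  have dxD : d \notin x |: D by rewrite finset.in_setU1 negb_or dx.
  apply: leq_trans (s8 d dD' dxD) _.
  by apply: subset_leq_card; apply: finset.setIS; apply: finset.subsetDl.
Qed.

(** Double count of incidences between [U] and closed neighbourhoods: those centred in [D] miss [U],
    the others contain at most [k] of its vertices. *)
Let phase_bound k D U : D \subset W -> U \subset T ->
  {in D, forall d, N d :&: U = finset.set0} ->
  {in W, forall x, #|N x :&: U| <= k}%N -> (4 * #|U| <= k * (#|W| - #|D|))%N.
Proof.
move=> DW UT DU Uk; rewrite -(incidences UT).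
rewrite (big_setID D) /= (finset.setIidPr DW) big1 => [|d /DU->]; last by rewrite cards0.
rewrite add0n -cardsDS // mulnC -sum_nat_const; apply: leq_sum => x.
by rewrite finset.inE => /andP[_ /Uk].
Qed.

(** The greedy choice runs in four phases, gaining 4, 3, 2 and 1 newly dominated vertices per
    choice; [U1], [U2], [U3] are what remains after the first three, and the fourth leaves
    nothing. *)
Lemma cubic_dominating : exists D, [/\ D \subset W, (50 * #|D| <= 23 * #|W|)%N &
  forall x, x \in W -> #|nbrs E x| = 3%N -> exists2 d, d \in D & (d == x) || E x d].
Proof.
have arith1 (n d c w s t : nat) : c = (4 * d)%N -> (d <= c)%N -> (c <= n)%N ->
    w = (n - c)%N -> (s <= 2 * (c - d))%N -> (t <= 3 * w)%N ->
    (0 + s + t + 6 * d <= 3 * n)%N by lia.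
(* The phase counts form a linear program whose optimum for [k / n] is 23/50. *)
have arith2 (n t u1 u2 u3 d1 d2 d3 k : nat) : (t <= n)%N -> (d2 <= n)%N -> (d3 <= n)%N ->
    (t + 4 * 0 = u1 + 4 * d1)%N -> (u1 + 3 * d1 = u2 + 3 * d2)%N ->
    (u2 + 2 * d2 = u3 + 2 * d3)%N -> (u3 + 1 * d3 = 0 + 1 * k)%N ->
    (4 * u1 + 6 * d1 <= 3 * n)%N -> (4 * u2 <= 2 * (n - d2))%N ->
    (4 * u3 <= 1 * (n - d3))%N -> (50 * k <= 23 * n)%N by lia.
have arith3 (a b c e : nat) : (a = 1 + b)%N -> (b = 1 + c)%N -> (a <= 4)%N -> (e <= c)%N ->
    (e <= 2)%N by lia.
have TW : T \subset W by apply/fintype.subsetP => x; rewrite finset.inE => /andP[].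
have [|||D1 [U1 [_ w1 e1 [b1 s1 c1 v1 m1]]]] := @phase 3 finset.set0 T.
- exact: finset.sub0set.
- by move=> d; rewrite finset.inE.
- by move=> x _; apply: leq_trans (card_N x); apply: subset_leq_card; apply: finset.subsetIl.
have [D2 [U2 [d2 w2 e2 [b2 s2 c2 v2 _]]]] := phase w1 e1 b1.
have [D3 [U3 [d3 w3 e3 [b3 s3 c3 v3 _]]]] := phase w2 e2 b2.
have [D4 [U4 [d4 w4 e4 [b4 s4 c4 v4 _]]]] := phase w3 e3 b3.
have s2' := fintype.subset_trans s2 s1; have s3' := fintype.subset_trans s3 s2'.
have i2 := phase_bound w2 s2' e2 b2; have i3 := phase_bound w3 s3' e3 b3.
have U40 : U4 = finset.set0.
  apply/setP => u; rewrite finset.in_set0; apply/negP => uU.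
  have uW : u \in W.
    by apply: (fintype.subsetP TW); apply: (fintype.subsetP s3'); apply: (fintype.subsetP s4).
  have := b4 u uW; rewrite leqn0 cards_eq0 => /eqP/setP/(_ u).
  by rewrite finset.in_setI uU mem_N eqxx finset.in_set0.
(* Sharper than [phase_bound]. Closed neighbourhoods chosen in the first phase lie in [T] and fill
   [C], with [4 |D1|] vertices. A vertex of [C] outside [D1] sees at most two of [U1], since neither
   it nor its dominator lies there. *)
have i1 : (4 * #|U1| + 6 * #|D1| <= 3 * #|W|)%N.
  have D1N d : d \in D1 -> N d \subset T.
    move=> dD; have := m1 d dD; rewrite finset.in_set0 => /(_ isT) h.
    have /eqP <- : N d :&: T == N d; last exact: finset.subsetIr.
    by rewrite eqEcard finset.subsetIl (leq_trans (card_N d)).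
  pose C := T :\: U1.
  have CC : #|C| = (4 * #|D1|)%N.
    by rewrite /C (cardsDS s1); move: c1; rewrite cards0 muln0 addn0 => ->; rewrite addKn.
  have D1C : D1 \subset C.
    apply/fintype.subsetP => d dD; rewrite finset.inE (fintype.subsetP (D1N d dD)) ?mem_N ?eqxx //.
    rewrite andbT; apply/negP => dU; have /setP/(_ d) := e1 d dD.
    by rewrite finset.inE mem_N eqxx dU finset.inE.
  have CW : C \subset W by apply: fintype.subset_trans TW; apply: finset.subsetDl.
  rewrite -(incidences s1) (big_setID C) /= (finset.setIidPr CW) (big_setID D1) /= (finset.setIidPr D1C).
  rewrite big1 => [|d /e1->]; last by rewrite cards0.
  have h1 : (\sum_(x in C :\: D1) #|N x :&: U1| <= 2 * #|C :\: D1|)%N.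
    rewrite mulnC -sum_nat_const; apply: leq_sum => x /finset.setDP[/finset.setDP[xT xU] xD].
    have [d dD xd] := v1 x xT xU.
    have sub : N x :&: U1 \subset N x :\ x :\ d.
      apply/fintype.subsetP => y; rewrite finset.in_setI !finset.in_setD1 => /andP[-> yU].
      rewrite andbT; apply/andP; split; apply: contraTneq yU => -> //.
      apply/negP => dU; have /setP/(_ d) := e1 d dD.
      by rewrite finset.inE mem_N eqxx dU finset.inE.
    apply: (arith3 _ _ _ _ _ _ (card_N x) (subset_leq_card sub)).
      by rewrite (cardsD1 x (N x)) mem_N eqxx.
    rewrite (cardsD1 d (N x :\ x)) finset.in_setD1 N_sym xd andbT.
    by have -> : d != x by apply: contraNneq xD => <-.
  have h2 : (\sum_(x in W :\: C) #|N x :&: U1| <= 3 * #|W :\: C|)%N.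
    rewrite mulnC -sum_nat_const; apply: leq_sum => x.
    by rewrite finset.inE => /andP[_ /b1].
  apply: (arith1 _ _ _ _ _ _ CC (subset_leq_card D1C) (subset_leq_card CW) (cardsDS CW) _ h2).
  by rewrite -(cardsDS D1C).
exists D4; split => //.
  move: c1 c4; rewrite U40 !cards0 => c1 c4.
  exact: (arith2 _ _ _ _ _ _ _ _ _ (subset_leq_card TW) (subset_leq_card w2)
    (subset_leq_card w3) c1 c2 c3 c4 i1 i2 i3).
move=> x xW x3; have xT : x \in T by rewrite finset.inE xW x3.
have [d dD xd] : exists2 d, d \in D4 & x \in N d.
  have [x1|/(v1 x xT)[d /(fintype.subsetP d2)/(fintype.subsetP d3)/(fintype.subsetP d4)]] := boolP (x \in U1); last by exists d.
  have [x2|/(v2 x x1)[d /(fintype.subsetP d3)/(fintype.subsetP d4)]] := boolP (x \in U2); last by exists d.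
  have [x3'|/(v3 x x2)[d /(fintype.subsetP d4)]] := boolP (x \in U3); last by exists d.
  by apply: (v4 x x3'); rewrite U40 finset.inE.
by exists d => //; rewrite eq_sym E_sym -mem_N.
Qed.

End Cubic.

(** * Sizes of the degree classes, and the degree sum *)

Section DegreeClasses.
Variable G : sgraph.
Implicit Types (u v w x y : G) (S : {set G}).

Definition degree_class d : {set G} := [set v | degree v == d].

Definition class_adj d : rel G :=
  fun x y => [&& adj x y, degree x == d & degree y == d].

Lemma alpha2reg_ge S : same_degree S ->
  (forall v, v \in S -> (induced_degree S v <= 2)%N) -> (#|S| <= alpha2reg G)%N.
Proof.
move=> sS dS.
apply: (@leq_bigmax_cond _ (fun S => same_degree S && (induced_max_degree S <= 2)%N)
  (fun S : {set G} => #|S|)).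
by rewrite sS /=; apply/bigmax_leqP.
Qed.

Lemma alpha2reg_class d S : S \subset degree_class d ->
  (forall v, v \in S -> (#|[set w in S | class_adj d v w]| <= 2)%N) ->
  (#|S| <= alpha2reg G)%N.
Proof.
move=> /fintype.subsetP Sd dS; have deg v : v \in S -> degree v == d.
  by move=> /Sd; rewrite finset.inE.
apply: alpha2reg_ge.
  by apply/forall_inP => u /deg/eqP->; apply/forall_inP => v /deg; rewrite eq_sym.
move=> v vS; apply: leq_trans (dS v vS); apply: subset_leq_card.
apply/fintype.subsetP => w; rewrite !finset.inE => /andP[wS vw].
by rewrite wS /class_adj vw !deg.
Qed.

Lemma alpha2reg_gt0 : (0 < #|G|)%N -> (0 < alpha2reg G)%N.
Proof.
case/card_gt0P => v _; rewrite -(cards1 v); apply: alpha2reg_ge.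
  by apply/forall_inP => u /finset.set1P->; apply/forall_inP => w /finset.set1P->.
move=> u /finset.set1P->; rewrite (_ : induced_degree _ _ = 0%N) //.
apply/eqP; rewrite cards_eq0; apply/eqP/setP => w; rewrite !finset.inE.
by case: eqVneq => // ->; rewrite adj_irrefl.
Qed.

Lemma class_adj_sym d : symmetric (class_adj d).
Proof. by move=> x y; rewrite /class_adj adj_sym (andbC (degree x == d)). Qed.

Lemma class_adj_irrefl d : irreflexive (class_adj d).
Proof. by move=> x; rewrite /class_adj adj_irrefl. Qed.

Lemma class_adj_sub d x y : class_adj d x y ->
  (x \in degree_class d) && (y \in degree_class d).
Proof. by rewrite !finset.inE => /and3P[_ -> ->]. Qed.

Lemma class_adj_degree d x : (#|nbrs (class_adj d) x| <= d)%N.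
Proof.
have [/eqP <-|nx] := boolP (degree x == d).
  apply: subset_leq_card; apply/fintype.subsetP => y.
  by rewrite !finset.inE => /andP[].
rewrite (_ : nbrs _ _ = finset.set0) ?cards0 //.
by apply/setP => y; rewrite !finset.inE /class_adj (negbTE nx) andbF.
Qed.

Lemma degree_class_le d k : (d < 3 * k)%N ->
  (#|degree_class d| <= k * alpha2reg G)%N.
Proof.
move=> dk; apply: (colour_class (@class_adj_sym d) (@class_adj_irrefl d) _ dk).
  exact: class_adj_degree.
by move=> S; apply: alpha2reg_class.
Qed.

(** A dominating set of at most 23/50 of the class is deleted; the remaining 27/50 or more induce
    degree at most 2. *)
Lemma degree_class3 : (27 * #|degree_class 3%N| <= 50 * alpha2reg G)%N.
Proof.
have [D [DW D23 dom]] := cubic_dominating (@class_adj_sym 3%N) (@class_adj_irrefl 3%N)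
  (@class_adj_sub 3%N) (class_adj_degree 3%N).
have : (#|degree_class 3%N :\: D| <= alpha2reg G)%N.
  apply: (@alpha2reg_class 3%N); first exact: finset.subsetDl.
  move=> v; rewrite finset.inE => /andP[vD vW].
  have [n3|n3] := eqVneq #|nbrs (class_adj 3%N) v| 3%N; last first.
    have sub : [set w in degree_class 3%N :\: D | class_adj 3%N v w]%SET
      \subset nbrs (class_adj 3%N) v.
      by apply/fintype.subsetP => w; rewrite !finset.inE => /andP[].
    apply: leq_trans (subset_leq_card sub) _.
    by rewrite -ltnS ltn_neqAle n3 class_adj_degree.
  have [d dD /orP[/eqP e|vd]] := dom v vW n3; first by rewrite -e dD in vD.
  have sub : [set w in degree_class 3%N :\: D | class_adj 3%N v w]%SET
      \subset nbrs (class_adj 3%N) v :\ d.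
    apply/fintype.subsetP => w; rewrite !finset.inE => /andP[/andP[wD _] ->].
    by rewrite andbT; apply: contraNneq wD => ->.
  apply: leq_trans (subset_leq_card sub) _.
  have vd' : d \in nbrs (class_adj 3%N) v by rewrite finset.inE.
  by have := cardsD1 d (nbrs (class_adj 3%N) v); rewrite vd' n3; lia.
by rewrite (cardsDS DW); lia.
Qed.

(** Vertices are grouped by degree; truncated subtraction gives 0 from degree [K] on. *)
Lemma deficiency K :
  (\sum_(v : G) (K - degree v) = \sum_(d < K) (K - d) * #|degree_class d|)%N.
Proof.
transitivity (\sum_(v : G) \sum_(d < K) (degree v == d :> nat) * (K - d))%N.
  apply: eq_bigr => v _; have [vK|Kv] := ltnP (degree v) K.
    rewrite (bigD1 (Ordinal vK)) //= eqxx mul1n big1 ?addn0 // => d dv.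
    by case: eqVneq => // e; case/eqP: dv; apply: val_inj.
  rewrite big1 => [|d _]; first by lia.
  by rewrite gtn_eqF // (leq_trans (ltn_ord d)).
rewrite exchange_big /=; apply: eq_bigr => d _.
rewrite -big_distrl /= mulnC; congr muln.
rewrite -sum1_card [RHS]big_mkcond /=; apply: eq_bigr => v _.
by rewrite finset.inE; case: (_ == _).
Qed.

Lemma deficiency_bound K :
  (K * #|G| <= 2 * #|edges G| + \sum_(d < K) (K - d) * #|degree_class d|)%N.
Proof.
rewrite -deficiency -degree_sum -big_split /= mulnC -sum_nat_const.
by apply: leq_sum => v _; lia.
Qed.

Lemma min_degree_le v : (min_degree G <= degree v)%N.
Proof.
rewrite /min_degree; have : v \in index_enum G by rewrite mem_index_enum.
elim: (index_enum G) => //= u s IH; rewrite big_cons !inE => /predU1P[<-|/IH].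
  exact: geq_minl.
exact/leq_trans/geq_minr.
Qed.

Lemma degree_class_min d : (d < min_degree G)%N -> #|degree_class d| = 0%N.
Proof.
move=> h; apply/eqP; rewrite cards_eq0; apply/eqP/setP => v.
by rewrite !finset.inE; apply/negbTE; have := min_degree_le v; lia.
Qed.

Lemma min_degree_lt : (0 < #|G|)%N -> (min_degree G < #|G|)%N.
Proof.
case/card_gt0P => v _; apply: leq_ltn_trans (min_degree_le v) _.
rewrite -cardsT; apply: proper_card; apply/properP; split; first exact: finset.subsetT.
by exists v; rewrite !finset.inE // adj_irrefl.
Qed.

End DegreeClasses.

(** * A triangulation on n vertices *)

Section Bipyramid.
Variables (R : realType) (m : nat).
Local Open Scope classical_set_scope.
Implicit Types (a b : bool) (i j : 'I_m).

(* The join of an edge with a path: a triangulation, with 3n - 6 edges. *)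
Definition bipyramid_adj : rel (bool + 'I_m)%type := fun u v =>
  match u, v with
  | inl a, inl b => a != b
  | inr i, inr j => (i.+1 == j)%N || (j.+1 == i)%N
  | _, _ => true
  end.

Lemma bipyramid_sym : symmetric bipyramid_adj.
Proof. by case=> [a|i] [b|j] //=; rewrite ?(eq_sym a) // orbC. Qed.

Lemma bipyramid_irrefl : irreflexive bipyramid_adj.
Proof. by case=> [a|i] /=; rewrite ?eqxx // orbb; apply/eqP; lia. Qed.

Definition bipyramid := SGraph bipyramid_sym bipyramid_irrefl.

Lemma card_bipyramid : #|bipyramid| = m.+2.
Proof. by rewrite card_sum card_bool card_ord. Qed.

Lemma sum_eq_ord (n k : nat) : (\sum_(j < n) (k == j) = (k < n))%N.
Proof.
have [kn|nk] := ltnP k n.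
  rewrite (bigD1 (Ordinal kn)) //= eqxx big1 // => j jk.
  by case: eqVneq => // e; case/eqP: jk; apply: val_inj.
by rewrite big1 // => j _; rewrite gtn_eqF // (leq_trans (ltn_ord j)).
Qed.

(** One axis, [2 m] sides and [m - 1] path edges; [3 m] is [3 n - 6] for [n = m + 2]. *)
Lemma bipyramid_edges : (0 < m)%N -> (3 * m <= #|edges bipyramid|)%N.
Proof.
move=> m0; rewrite -(leq_pmul2l (isT : 0 < 2)%N) -arcs_edges arcs_sum.
have card_nbrs u : (#|nbrs bipyramid_adj u| = \sum_w (bipyramid_adj u w))%N.
  rewrite -sum1_card big_mkcond; apply: eq_bigr => w _.
  by rewrite finset.inE; case: bipyramid_adj.
rewrite big_sumType /= big_bool (eq_bigr (fun i : 'I_m => 2 + ((i.+1 < m) + (0 < i))))%N; last first.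
  move=> i _; rewrite card_nbrs big_sumType /= big_bool; congr addn.
  have pred_sum : (\sum_(j < m) (j.+1 == i) = (0 < i))%N.
    case: i => -[|k] km /=; first by rewrite big1.
    by under eq_bigr do rewrite eqSS eq_sym; rewrite sum_eq_ord ltnW.
  rewrite -pred_sum -sum_eq_ord -big_split /=; apply: eq_bigr => j _.
  by case: eqVneq => [<-|_]; case: eqVneq => //; lia.
rewrite !card_nbrs !big_sumType /= !big_bool /= !sum_nat_const !card_ord.
rewrite !big_split /= sum_nat_const card_ord.
case: (m) m0 => // k _.
have -> : (\sum_(i < k.+1) (i.+1 < k.+1) = k)%N.
  rewrite big_ord_recr /= ltnn addn0 -[RHS]muln1 -[k in RHS]card_ord -sum_nat_const.
  by apply: eq_bigr => i _; rewrite ltnS ltn_ord.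
have -> : (\sum_(i < k.+1) (0 < i) = k)%N.
  by rewrite big_ord_recl /= add0n sum_nat_const card_ord muln1.
lia.
Qed.

Definition bipyramid_point (v : bipyramid) : R * R :=
  match v with
  | inl a => (0, if a then 1 else -1)
  | inr i => (i.+1%:R, 0)
  end.

Local Notation pos := bipyramid_point.

Definition segment (x y : R * R) : set (R * R) :=
  [set x + t *: (y - x) | t in `[0, 1]].

Lemma segment_sym x y : segment x y = segment y x.
Proof.
suff sub u v : segment u v `<=` segment v u by apply/seteqP; split; apply: sub.
move=> _ [t /= + <-]; rewrite in_itv /= => /andP[t0 t1]; exists (1 - t).
  by rewrite /= in_itv /=; apply/andP; split; lra.
by case: u v => [u1 u2] [v1 v2]; congr pair; rewrite /= /GRing.scale /=; ring.
Qed.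

Lemma segment_arc x y : x != y -> arc_between x y (segment x y).
Proof.
move=> xy; exists (fun t => x + t *: (y - x)); split => //.
- apply: continuous_subspaceT => t; apply: cvgD; first exact: cvg_cst.
  by apply: cvgZr_tmp; exact: cvg_id.
- move=> s t _ _ /addrI/eqP; rewrite -subr_eq0 -scalerBl scaler_eq0 subr_eq0 => /orP[/eqP //|].
  by rewrite subr_eq0 eq_sym (negbTE xy).
- by rewrite scale0r addr0.
- by rewrite scale1r addrC subrK.
Qed.

Lemma bipyramid_point_inj : injective pos.
Proof.
case=> [a|i] [b|j] // [].
- by case: a; case: b => // h; exfalso; lra.
- by move/eqP; rewrite eq_sym pnatr_eq0.
- by move/eqP; rewrite pnatr_eq0.
- by move/eqP; rewrite eqr_nat eqSS => /eqP h; congr inr; apply: val_inj.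
Qed.

(** What is needed about a point of a straight edge, with each side directed away from its apex and
    each path edge to the right; this reduces crossings to linear arithmetic. *)
Variant edge_shape (z : R * R) : bipyramid -> bipyramid -> Prop :=
| Axis a of z.1 = 0 : edge_shape z (inl a) (inl (~~ a))
| Side a i t of 0 <= t <= 1 & z.1 = t * i.+1%:R &
    z.2 = (1 - t) * (if a then 1 else -1) : edge_shape z (inl a) (inr i)
| Base i j of i.+1 = j & i.+1%:R <= z.1 <= i.+1%:R + 1 & z.2 = 0 :
    edge_shape z (inr i) (inr j).

Lemma segmentP x y z : segment x y z -> exists t : R,
  [/\ 0 <= t <= 1, z.1 = x.1 + t * (y.1 - x.1) & z.2 = x.2 + t * (y.2 - x.2)].
Proof. by move=> [t /=]; rewrite in_itv /= => ht <-; exists t. Qed.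

Lemma edge_shapeP (u v : bipyramid) z : adj u v -> segment (pos u) (pos v) z ->
  edge_shape z u v \/ edge_shape z v u.
Proof.
move=> + /segmentP[t []].
case: u v => [a|i] [b|j] /= uv /andP[t0 t1] z1 z2.
- left; have -> : b = ~~ a by move: uv; case: (a); case: (b).
  by constructor; rewrite z1; ring.
- by left; apply: (@Side _ _ _ t); rewrite ?t0 ?z1 ?z2 //; case: (a); ring.
- right; apply: (@Side _ _ _ (1 - t)); rewrite ?z1 ?z2.
  + by apply/andP; split; lra.
  + by ring.
  + by case: (b); ring.
- case/orP: uv => /eqP e; [left | right]; apply: Base => //.
  + by rewrite z1 -e [i.+2%:R]mulrSr; apply/andP; split; lra.
  + by rewrite z2; ring.
  + by rewrite z1 -e [j.+2%:R]mulrSr; apply/andP; split; lra.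
  + by rewrite z2; ring.
Qed.

Lemma edge_shape_meet z (u v u' v' : bipyramid) :
  edge_shape z u v -> edge_shape z u' v' ->
  range pos z \/ [set u; v]%SET = [set u'; v']%SET.
Proof.
have Rgt0 k : 0 < k.+1%:R :> R by rewrite ltr0n.
have vertex w : z.1 = (pos w).1 -> z.2 = (pos w).2 -> range pos z.
  by case: z => z1 z2 /= -> ->; exists w => //; case: (pos w).
have axis_side a i (t : R) : z.1 = 0 -> z.1 = t * i.+1%:R ->
    z.2 = (1 - t) * (if a then 1 else -1) -> range pos z.
  move=> z0 z1 z2; apply: (vertex (inl a)) => //=.
  move: z1; rewrite z0 => /esym/eqP.
  rewrite mulf_eq0 (gt_eqF (Rgt0 _)) orbF => /eqP t0.
  by rewrite z2 t0 subr0 mul1r.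
have axis_base i : z.1 = 0 -> i.+1%:R <= z.1 <= i.+1%:R + 1 -> False.
  by have := Rgt0 i => ? -> /andP[? _]; lra.
have side_end a i (t : R) : t = 1 -> z.1 = t * i.+1%:R ->
    z.2 = (1 - t) * (if a then 1 else -1) -> range pos z.
  move=> t1 z1 z2; apply: (vertex (inr i)); rewrite /= ?z1 ?z2 t1 ?mul1r //.
  by rewrite subrr mul0r.
have side_base a i (t : R) : z.2 = 0 -> z.1 = t * i.+1%:R ->
    z.2 = (1 - t) * (if a then 1 else -1) -> range pos z.
  move=> z0 z1 z2; apply: (@side_end a i t) => //.
  by move: z2; rewrite z0; case: (a) => h; lra.
have base_base i i' : (i < i')%N -> i.+1%:R <= z.1 <= i.+1%:R + 1 ->
    i'.+1%:R <= z.1 <= i'.+1%:R + 1 -> z.2 = 0 -> range pos z.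
  move=> ii /andP[_ h1] /andP[h2 _] z2; apply: (vertex (inr i')) => //=.
  have : i.+2%:R <= i'.+1%:R :> R by rewrite ler_nat.
  by rewrite [i.+2%:R]mulrSr; lra.
move=> [a z1|a i t /andP[t0 t1] z1 z2|i j ij z1 z2]
  [a' z1'|a' i' t' /andP[t0' t1'] z1' z2'|i' j' ij' z1' z2'].
- by right; case: a; case: a'; rewrite //= finset.setUC.
- by left; apply: axis_side z1 z1' z2'.
- by case: (axis_base i').
- by left; apply: axis_side z1' z1 z2.
(* Sides at different apices have heights of opposite sign and can meet only on the path; sides at
   the same apex have equal parameters by their heights, so they meet at the apex or coincide. *)
- have [aa|aa] := eqVneq a a'; last first.
    left; apply: (side_end a i t) => //.
    by move: z2' aa; rewrite z2; case: (a); case: (a') => // h _; lra.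
  have tt : t' = t by move: z2'; rewrite z2 -aa; case: (a) => h; lra.
  have [t_0|t_n0] := eqVneq t 0.
    by left; apply: (vertex (inl a)); rewrite /= ?z1 ?z2 t_0 ?mul0r // subr0 mul1r.
  right; rewrite aa; congr [set _; inr _]%SET; apply: val_inj.
  move: z1'; rewrite z1 tt => /(mulfI t_n0)/eqP.
  by rewrite eqr_nat eqSS => /eqP.
- by left; apply: side_base z2' z1 z2.
- by case: (axis_base i).
- by left; apply: side_base z2 z1' z2'.
- case: (ltngtP i i') => [ii|ii|/val_inj ii].
  + by left; apply: base_base ii z1 z1' z2.
  + by left; apply: base_base ii z1' z1 z2.
  + by right; rewrite ii; congr [set _; inr _]%SET; apply: val_inj; rewrite /= -ij -ij' ii.
Qed.

Lemma edge_shape_vertex (u v w : bipyramid) :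
  edge_shape (pos w) u v -> w = u \/ w = v.
Proof.
have Rgt0 k : 0 < k.+1%:R :> R by rewrite ltr0n.
move e : (pos w) => z s; case: s e => {u v} [a z1|a i t /andP[t0 t1] z1 z2|i j ij z1 z2].
- case: w => [b|k] ez; last by have := Rgt0 k; move: z1; rewrite -ez /= => ->; rewrite ltxx.
  by case: a {z1}; case: b {ez}; [left | right | right | left].
- case: w => [b|k] ez.
    left; move: z1 z2; rewrite -ez /= => /esym/eqP.
    rewrite mulf_eq0 (gt_eqF (Rgt0 _)) orbF => /eqP->; rewrite subr0 mul1r.
    by case: (a); case: (b) => // h; exfalso; lra.
  right; congr inr; apply: val_inj.
  have t_1 : t = 1 by move: z2; rewrite -ez /=; case: (a) => h; lra.
  by move: z1; rewrite -ez /= t_1 mul1r => /eqP; rewrite eqr_nat eqSS => /eqP.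
- case: w => [b|k] ez.
    by exfalso; have := Rgt0 i; move: z1; rewrite -ez /= => /andP[]; lra.
  move: z1; rewrite -ez /= -mulrSr !ler_nat => /andP[h1 h2].
  have [ki|ki] : (k = i :> nat) \/ (k = j :> nat) by lia.
    by left; congr inr; apply: val_inj.
  by right; congr inr; apply: val_inj.
Qed.

Lemma bipyramid_planar : planar R bipyramid.
Proof.
exists pos, (fun u v => segment (pos u) (pos v)); split.
- exact: bipyramid_point_inj.
- move=> u v uv; apply: segment_arc; rewrite (inj_eq bipyramid_point_inj).
  by apply: contraTneq uv => ->; rewrite adj_irrefl.
- by move=> u v _; apply: segment_sym.
- by move=> u v w uv /(edge_shapeP uv)[] /edge_shape_vertex []; [left|right|right|left].
move=> u v x y uv xy neq z [/(edge_shapeP uv) h1 /(edge_shapeP xy) h2].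
have yx : [set y; x]%SET = [set x; y]%SET by apply: finset.setUC.
have vu : [set v; u]%SET = [set u; v]%SET by apply: finset.setUC.
by case: h1 h2 => h1 [] h2; case: (edge_shape_meet h1 h2) => // e; case/eqP: neq;
  move: e; rewrite ?yx ?vu.
Qed.

End Bipyramid.

(** Maximality is tested against the bipyramid of the same order. *)
Lemma maximal_planar_edges (R : realType) (G : sgraph) :
  maximal_planar R G -> (2 < #|G|)%N -> (3 * #|G| <= #|edges G| + 6)%N.
Proof.
move=> [_ maxG] n3; have := maxG (bipyramid (#|G| - 2)) (bipyramid_planar R _).
rewrite card_bipyramid => /(_ _) h.
have := @bipyramid_edges (#|G| - 2); have {h} := h _; lia.
Qed.

(** * Counting *)

Section Counting.
Variables (R : realType) (G : sgraph).
Implicit Types (u v : G).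

(* If all three neighbours of a vertex of degree 3 had degree 3, deleting the
   four vertices would remove too few edges. *)
Lemma maximal_planar_class3 : maximal_planar R G -> (8 < #|G|)%N ->
  (#|degree_class G 3%N| <= alpha2reg G)%N.
Proof.
move=> maxG n9; have planarG := proj1 maxG.
have e_lb : (3 * #|G| <= #|edges G| + 6)%N by apply: maximal_planar_edges maxG _; lia.
apply: (alpha2reg_class (d := 3%N)) => // u; rewrite finset.inE => /eqP u3.
rewrite leqNgt; apply/negP => many.
pose S : {set G} := u |: nbrs (@adj G) u.
have cS : #|S| = 4%N by rewrite cardsU1 finset.inE adj_irrefl -/(degree u) u3.
have /eqP nb : [set w in degree_class G 3%N | class_adj 3%N u w]%SET ==
    nbrs (@adj G) u.
  rewrite eqEcard -/(degree u) u3 many andbT; apply/fintype.subsetP => w.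
  by rewrite !finset.inE => /and3P[_ ->].
have degS v : v \in S -> degree v = 3%N.
  case/setU1P => [->//|]; rewrite -nb !finset.inE.
  by move=> /and4P[/eqP].
have sumS : (\sum_(v in S) degree v = 12)%N.
  by rewrite (eq_bigr (fun=> 3%N)) // sum_nat_const cS.
have cSC : (#|~: S|%SET = #|G| - 4)%N by have := cardsC S; rewrite cS; lia.
have two : (2 <= #|[set z : G * G | [&& z.1 \in S, z.2 \in S & adj z.1 z.2]]%SET|)%N.
  have /card_gt0P[w] : (0 < #|nbrs (@adj G) u|)%N by rewrite -/(degree u) u3.
  rewrite finset.inE => uw.
  have -> : 2%N = #|[set (u, w); (w, u)]%SET|.
    rewrite cards2 xpair_eqE; have -> : (u == w) = false; last by [].
    by apply/eqP => e; move: uw; rewrite e adj_irrefl.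
  apply: subset_leq_card; apply/fintype.subsetP => z.
  by rewrite !finset.inE => /orP[] /eqP-> /=;
     rewrite ?finset.inE ?eqxx ?uw ?orbT // adj_sym uw.
(* This gives [2 e + 10 + 2 < 6 (n - 4) + 2 * 12 = 6 n], against [e >= 3 n - 6]. *)
have := planar_edges_off planarG (S := S) _.
rewrite cSC sumS => h; have {}h := h (_ : 2 < #|G| - 4)%N.
by have := h _; lia.
Qed.

Lemma rat_bound (c k m n a : nat) : (0 < k)%N -> (c * (n + m) <= k * a)%N ->
  a%:R >= c%:R / k%:R * (n%:R + m%:R) :> rat.
Proof.
by move=> k0 h; rewrite mulrAC ler_pdivrMr ?ltr0n // -natrD -!natrM ler_nat (mulnC a).
Qed.

End Counting.

(** * Assembly of the bounds for each minimum degree *)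

Unset Implicit Arguments.

Theorem mainTheorem5 (R : realType) (G : sgraph) (n delta : nat)
  (order_G : #|G| = n) (min_degree_G : min_degree G = delta) :
  (planar R G ->
    (delta = 1%N -> (alpha2reg G)%:R >= 4 / 83 * (n%:R + 3) :> rat) /\
    (delta = 2%N -> (alpha2reg G)%:R >= 3 / 55 * (n%:R + 4) :> rat) /\
    (delta = 3%N -> (alpha2reg G)%:R >= 1 / 16 * (n%:R + 4) :> rat) /\
    (delta = 4%N -> (alpha2reg G)%:R >= 2 / 23 * (n%:R + 6) :> rat) /\
    (delta = 5%N -> (alpha2reg G)%:R >= 1 / 7 * (n%:R + 12) :> rat) /\
    (maximal_planar R G -> delta = 3%N ->
      (alpha2reg G)%:R >= 1 / 14 * (n%:R + 6) :> rat)) /\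
  (outerplanar R G -> delta = 2%N ->
    (alpha2reg G)%:R >= 1 / 8 * (n%:R + 3) :> rat).
Proof.
(* On the empty graph the default value makes the minimum degree 0. *)
have n0 : (0 < delta)%N -> (0 < n)%N.
  move=> d0; rewrite lt0n; apply: contraTneq d0 => n0.
  have e : G =i pred0 by apply: card0_eq; rewrite order_G.
  rewrite -min_degree_G /min_degree (eq_bigl xpred0) => [|v]; last by have := e v.
  by rewrite big_pred0_eq order_G n0.
have nd : (0 < delta)%N -> (delta < n)%N.
  by move/n0; rewrite -order_G -min_degree_G; apply: min_degree_lt.
have a0 : (0 < delta)%N -> (0 < alpha2reg G)%N.
  by move/n0; rewrite -order_G; apply: alpha2reg_gt0.
have k0 d : (d < delta)%N -> #|degree_class G d| = 0%N.
  by rewrite -min_degree_G; apply: degree_class_min.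
have D := deficiency_bound G; rewrite order_G in D.
have C := @degree_class_le G; have C3 := degree_class3 G.
(* In each case the number of colours is the least [k] with [d < 3 k]. *)
have C1 := C 1%N 1%N isT; have C2 := C 2%N 1%N isT; have C3' := C 3%N 2%N isT.
have C4 := C 4%N 2%N isT; have C5 := C 5%N 2%N isT; have C6 := C 6%N 3%N isT.
have C7 := C 7%N 3%N isT; have C8 := C 8%N 3%N isT; have C9 := C 9%N 4%N isT.
set a := alpha2reg G in a0 C1 C2 C3' C3 C4 C5 C6 C7 C8 C9 *.
have big6 := D 6%N; have big7 := D 7%N; have big8 := D 8%N; have big9 := D 9%N.
have big10 := D 10%N.
rewrite !big_ord_recl big_ord0 /= /bump /= !addn0 !add1n !subSS !subn0 in big6 big7 big8 big9 big10.
have outer_bound : outerplanar R G -> (1 < n)%N -> (#|edges G| + 3 <= 2 * n)%N.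
  by rewrite -order_G; apply: outerplanar_edges.
have planar_bound : planar R G -> (2 < n)%N -> (#|edges G| + 6 <= 3 * n)%N.
  by rewrite -order_G; apply: planar_edges.
move: (#|edges G|) big6 big7 big8 big9 big10 outer_bound planar_bound.
move=> e big6 big7 big8 big9 big10 outer_bound planar_bound.
split=> [pG|oG]; last first.
  move=> d2; rewrite d2 in nd k0; apply: (@rat_bound 1%N 8%N 3%N) => //.
  have eG := outer_bound oG.
  have e0 := k0 0%N isT; have e1 := k0 1%N isT; have {}nd := nd isT.
  (* Weights 4, 3, 2, 1 on the classes 2 to 5 give [2 n + 6 <= (4 + 6 + 4 + 2) a = 16 a]. *)
  by have := eG (ltnW nd); rewrite e0 e1 in big6; clear -C2 C3' C4 C5 big6; clearbody a; lia.
have eG := planar_bound pG.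
split=> [d1|]; first (rewrite d1 in nd k0 a0; apply: (@rat_bound 4%N 83%N 3%N) => //).
  have e0 := k0 0%N isT; have {}nd := nd isT; have {}a0 := a0 isT.
  (* The edge bound needs three vertices; below that the claimed value is less than 1. *)
  have [n3|n3] := ltnP 2 n; last by clear -n3 a0; clearbody a; lia.
  (* Here [4 n + 12 <= (70 + 7 * 50 / 27) a], and the coefficient is just below 83. *)
  have := eG n3; rewrite e0 in big10.
  by clear -C1 C2 C3 C4 C5 C6 C7 C8 C9 big10; clearbody a; lia.
split=> [d1|]; first (rewrite d1 in nd k0 a0; apply: (@rat_bound 3%N 55%N 4%N) => //).
  have e0 := k0 0%N isT; have e1 := k0 1%N isT; have {}nd := nd isT.
  have := eG nd; rewrite e0 e1 in big9.
  by clear -C2 C3' C4 C5 C6 C7 C8 big9; clearbody a; lia.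
split=> [d1|]; first (rewrite d1 in nd k0 a0; apply: (@rat_bound 1%N 16%N 4%N) => //).
  have e0 := k0 0%N isT; have e1 := k0 1%N isT; have e2 := k0 2%N isT.
  have {}nd := nd isT; have := eG (ltnW nd); rewrite e0 e1 e2 in big9.
  by clear -C3' C4 C5 C6 C7 C8 big9; clearbody a; lia.
split=> [d1|]; first (rewrite d1 in nd k0 a0; apply: (@rat_bound 2%N 23%N 6%N) => //).
  have e0 := k0 0%N isT; have e1 := k0 1%N isT; have e2 := k0 2%N isT.
  have e3 := k0 3%N isT.
  have {}nd := nd isT; have := eG (ltnW (ltnW nd)); rewrite e0 e1 e2 e3 in big8.
  by clear -C4 C5 C6 C7 big8; clearbody a; lia.
split=> [d1|maxG d1]; rewrite d1 in nd k0 a0.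
  apply: (@rat_bound 1%N 7%N 12%N) => //.
  have e0 := k0 0%N isT; have e1 := k0 1%N isT; have e2 := k0 2%N isT.
  have e3 := k0 3%N isT; have e4 := k0 4%N isT.
  have {}nd := nd isT; have := eG (ltnW (ltnW (ltnW nd))).
  rewrite e0 e1 e2 e3 e4 in big7.
  by clear -C5 C6 big7; clearbody a; lia.
apply: (@rat_bound 1%N 14%N 6%N) => //.
(* For [n <= 8] the claimed value is at most 1. *)
have [n9|n9] := ltnP 8 n; last by have {}a0 := a0 isT; clear -n9 a0; clearbody a; lia.
have e0 := k0 0%N isT; have e1 := k0 1%N isT; have e2 := k0 2%N isT.
have C3m : (#|degree_class G 3%N| <= a)%N.
  by apply: maximal_planar_class3 maxG _; rewrite order_G.
(* Compared with minimum degree 4, the class of degree 3 adds only [5 a]: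
   [2 n + 12 <= (5 + 23) a]. *)
have {}nd := nd isT; have := eG (ltnW nd); rewrite e0 e1 e2 in big8.
by clear -C3m C4 C5 C6 C7 big8; clearbody a; lia.
Qed.
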